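(* Let $L=10^6$. Let $\mathbb{V}=\{(i,j)\in\mathbb{Z}^2: i+j\text{ even}\}$ and let $\mathbb{E}$ be the set of oriented edges $((i,j),(i+1,j'))$ with $(i,j),(i+1,j')\in\mathbb{V}$ and $|j'-j|=1$. Let $\xi=(\xi_i)_{i\in\mathbb{Z}}$ be i.i.d. random variables with $\mathbb{P}(\xi_i\ge n)=\rho^n$ for $n\in\{0,1,2,\dots\}$, where $\rho\in[0,1]$. Given $\xi$ and $p\in[0,1]$, let $P^\xi_p$ be the law of the percolation on $(\mathbb{V},\mathbb{E})$ in which each edge $((i,j),(i+1,j\pm1))$ is open with probability $p^{\xi_i+1}$, independently of the others. If $\rho\le L^{-16}$ and $p\ge(1-L^{-10})^{1/4}$, then for almost every realization of $\xi$, $$P^\xi_p\big[(0,0)\text{ is connected to infinity}\big]>0.$$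
   Context: ''$(0,0)$ is connected to infinity'' means that there exist infinitely many vertices reachable from $(0,0)$ by oriented paths of open edges of $\mathbb{E}$ (equivalently, there is an infinite open oriented path starting at $(0,0)$). *)

(* Defs.v *)
From HB Require Import structures.
From mathcomp Require Import all_boot all_order all_algebra.
From mathcomp Require Import all_classical all_reals all_analysis.
Set Implicit Arguments. Unset Strict Implicit. Unset Printing Implicit Defensive.
Import Order.TTheory GRing.Theory Num.Theory.
Local Open Scope ring_scope.
Local Open Scope classical_set_scope.

Definition Lcst {R : nzRingType} : R := (10 ^ 6)%:R.

Definition vertex := (int * int)%type.
Definition edge := (vertex * vertex)%type.

Definition in_V (v : vertex) : bool := ((v.1 + v.2) %% 2 == 0)%Z.

Definition in_E (e : edge) : bool :=
  [&& in_V e.1, in_V e.2, e.2.1 == e.1.1 + 1 &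
      (e.2.2 == e.1.2 + 1) || (e.2.2 == e.1.2 - 1)].

Definition mutually_independent_events {d} {T : measurableType d} {R : realType}
  {Idx : eqType} (P : probability T R) (I : Idx -> bool) (A : Idx -> set T) : Prop :=
  forall s : seq Idx, uniq s -> all I s ->
    P (\big[setI/setT]_(k <- s) A k) = (\prod_(k <- s) P (A k))%E.

Definition mutually_independent_rv {d} {T : measurableType d} {R : realType}
  (P : probability T R) (X : int -> T -> nat) : Prop :=
  forall (s : seq int) (B : int -> set nat), uniq s ->
    P (\big[setI/setT]_(i <- s) (X i @^-1` B i)) = (\prod_(i <- s) P (X i @^-1` B i))%E.

Definition iid_geometric {d} {T : measurableType d} {R : realType}
  (Q : probability T R) (xi : int -> T -> nat) (rho : R) : Prop :=
  [/\ forall i (B : set nat), measurable (xi i @^-1` B),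
      mutually_independent_rv Q xi &
      forall i (n : nat), Q [set w | (n <= xi i w)%N] = (rho ^+ n)%:E].

Definition percolation_law {d} {T : measurableType d} {R : realType}
  (P : probability T R) (omega : edge -> T -> bool) (p : R) (xi : int -> nat) : Prop :=
  [/\ forall e, in_E e -> measurable [set w | omega e w],
      mutually_independent_events P in_E (fun e => [set w | omega e w]) &
      forall e, in_E e -> P [set w | omega e w] = (p ^+ (xi e.1.1).+1)%:E].

Definition connected_to_infinity {T : Type} (omega : edge -> T -> bool) : set T :=
  [set w | exists g : nat -> vertex, g 0%N = (0, 0) /\
      forall n, in_E (g n, g n.+1) /\ omega (g n, g n.+1) w].

(* Main.v *)
Require Import Defs.
From HB Require Import structures.
From mathcomp Require Import all_boot all_order all_algebra.
From mathcomp Require Import all_classical all_reals all_analysis.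
From mathcomp Require Import ring lra zify.
Import Order.TTheory GRing.Theory Num.Theory.
Set Implicit Arguments. Unset Strict Implicit. Unset Printing Implicit Defensive.
Local Open Scope ring_scope.

(** In the coordinates (i, (i + j) / 2) a path stays or moves up by one at each
    step.  Revealing, for each site, one edge from an occupied predecessor shows
    that the bond model dominates a site model whose coins in column i have bias
    1 / z_i, with z_i = p^-(xi_i + 1) i.i.d. and E z^8 close to 1.

    This site model is renormalized.  For a large t, put n = t^3 and s = t^2; a
    coarse site is a block of 2n slots of width s, occupied when every slot
    contains an occupied site.  Columns are grouped into cells of length 6ns; a
    cell is fine when its product of z's is at most t, and a coarse column is a
    run of cells up to the first fine one.  If P is the product over the cells
    that are not fine, each of the n slots facing the target block sends one path
    across the run; a path that enters the fine cell sweeps the target there, and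
    the side paths ("teeth") starting from it refill all slots.  With n attempts
    of probability at least 1 / (t P) the coarse coin has bias about
    min(1, t / P), so the coarse column is max(1, P / t) up to an error
    exponentially small in t.  The factor t makes its eighth moment smaller than
    1 + (t + 1)^-8 when the original one is at most 1 + t^-8, and the step can be
    iterated with t + 1.

    A single site fills a block with probability 1 - O(t^-3) in the annealed
    model; climbing through the levels, annealed survival from one site at level
    t is at least 1 - 1/t.  A level-(200 + k) site is a finite configuration of
    the original model, so an interval of sites has annealed survival probability
    at least 1 - 1/(200 + k).  By Markov's inequality and continuity of measure
    its quenched survival probability is at least 1/2 outside an event of
    probability 2/(200 + k), and the origin fills the interval with positive
    probability in every environment. *)

(** * Independent coins *)

Section IndependentCoins.
Context {R : realType}.

Definition depends (X : Type) (D : X -> Prop) (f : (X -> bool) -> R) : Prop :=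
  forall c c', (forall x, D x -> c x = c' x) -> f c = f c'.

(* Independence is stated for functions of disjoint sets of coins, so that no
   product measure is needed. *)
Record prodexp (X : Type) (E : ((X -> bool) -> R) -> R) : Prop := ProdExp {
  peD : forall f g, E (fun c => f c + g c) = E f + E g;
  peZ : forall a f, E (fun c => a * f c) = a * E f;
  pe_le : forall f g, (forall c, f c <= g c) -> E f <= E g;
  pe1 : E (fun _ => 1) = 1;
  pe_indep : forall (D : X -> Prop) f g,
    depends D f -> depends (fun x => ~ D x) g ->
    E (fun c => f c * g c) = E f * E g }.

Definition increasing (X : Type) (f : (X -> bool) -> R) : Prop :=
  forall A B : X -> bool, (forall x, A x -> B x) -> f A <= f B.

(* Coins with head probability [q] for the points of [s]; all other points show
   tails. *)
Fixpoint coin_exp (X : eqType) (q : R) (s : seq X) (f : (X -> bool) -> R) : R :=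
  if s is x :: s' then
    q * coin_exp q s' (fun c => f (fun y => (y == x) || c y)) + (1 - q) * coin_exp q s' f
  else f (fun _ => false).

Lemma coin_exp_cons (X : eqType) (q : R) (x : X) s f :
  coin_exp q (x :: s) f =
  q * coin_exp q s (fun c => f (fun y => (y == x) || c y)) + (1 - q) * coin_exp q s f.
Proof. by []. Qed.

Lemma sub_depends (X : Type) (D D' : X -> Prop) f :
  (forall x, D x -> D' x) -> depends D f -> depends D' f.
Proof. by move=> sDD' df c c' e; apply: df => x /sDD'; exact: e. Qed.

Section ProdExpTheory.
Context (X : Type) (E : ((X -> bool) -> R) -> R) (HE : prodexp E).

Lemma pe_cst a : E (fun _ => a) = a.
Proof.
rewrite -[RHS]mulr1 -(pe1 HE) -(peZ HE); congr E.
by apply/funext => c; rewrite mulr1.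
Qed.

Lemma peB f g : E (fun c => f c - g c) = E f - E g.
Proof.
rewrite -[- E g]mulN1r -(peZ HE) -(peD HE); congr E.
by apply/funext => c; rewrite mulN1r.
Qed.

Lemma pe_ge0 f : (forall c, 0 <= f c) -> 0 <= E f.
Proof. by move=> f0; rewrite -(pe_cst 0); apply: (pe_le HE). Qed.

Lemma pe_le1 f : (forall c, f c <= 1) -> E f <= 1.
Proof. by move=> f0; rewrite -(pe_cst 1); apply: (pe_le HE). Qed.

Lemma pe_indep2 (D D' : X -> Prop) f g :
  depends D f -> depends D' g -> (forall x, D x -> ~ D' x) ->
  E (fun c => f c * g c) = E f * E g.
Proof.
move=> df dg DD'; apply: (pe_indep HE df).
by apply: sub_depends dg => x D'x Dx; exact: (DD' x).
Qed.

End ProdExpTheory.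

Lemma coin_expD (X : eqType) q (s : seq X) f g :
  coin_exp q s (fun c => f c + g c) = coin_exp q s f + coin_exp q s g.
Proof. by elim: s f g => //= x s IH f g; rewrite !IH; ring. Qed.

Lemma coin_expZ (X : eqType) q (s : seq X) a f :
  coin_exp q s (fun c => a * f c) = a * coin_exp q s f.
Proof. by elim: s f => //= x s IH f; rewrite !IH; ring. Qed.

(** Independence goes by induction on the coins: the first coin lies in [D] or outside it, so
    forcing it to heads leaves one of [f], [g] unchanged. *)
Lemma coin_exp_prodexp (X : eqType) q (s : seq X) :
  0 <= q <= 1 -> prodexp (coin_exp q s).
Proof.
move=> /andP[q0 q1]; split; first exact: coin_expD.
- exact: coin_expZ.
- elim: s => [|x s IH] f g fg //=.
  by apply: lerD; apply: ler_wpM2l; rewrite ?subr_ge0 //; apply: IH.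
- by elim: s => //= x s IH; rewrite IH; ring.
- move=> D; elim: s => [|x s IH] f g df dg //=.
  set fx := fun c : X -> bool => f (fun y => (y == x) || c y).
  set gx := fun c : X -> bool => g (fun y => (y == x) || c y).
  have dfx : depends D fx.
    by move=> c c' e; apply: df => y Dy; rewrite e.
  have dgx : depends (fun y => ~ D y) gx.
    by move=> c c' e; apply: dg => y Dy; rewrite e.
  rewrite -/(coin_exp _ _ _) (IH fx gx) // (IH f g) //.
  have [Dx|Dx] := pselect (D x).
    have -> : gx = g.
      apply/funext => c; apply: dg => y Dy.
      by case: eqP => // yx; rewrite yx in Dy.
    ring.
  have -> : fx = f.
    apply/funext => c; apply: df => y Dy.
    by case: eqP => // yx; rewrite yx in Dy.
  ring.
Qed.

Lemma coin_exp_mem (X : eqType) q (s : seq X) x :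
  uniq s -> x \in s -> coin_exp q s (fun c => (c x)%:R) = q.
Proof.
have cst a (s' : seq X) : coin_exp q s' (fun _ => a) = a.
  by elim: s' => //= y s' ->; ring.
elim: s => //= y s IH /andP[ys us]; rewrite inE.
case: eqP => [-> _|_ /= xs] /=; last by rewrite IH //; ring.
rewrite cst; have -> : coin_exp q s (fun c => (c y)%:R) = 0.
  elim: s ys {us IH} => //= z s IH; rewrite inE negb_or => /andP[/negPf-> ys].
  by rewrite IH //; ring.
by ring.
Qed.

(** Stochastic domination, one point of [s] at a time: the expectation is affine in the probability
    of [H y], with non-negative slope because [G] is increasing, so this probability may be lowered
    to [q]. *)
Lemma dominate (X : Type) E (Y : eqType) (s : seq Y) q
    (H : Y -> (X -> bool) -> bool) (D : Y -> X -> Prop) G :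
  @prodexp X E -> uniq s -> 0 <= q ->
  (forall y, y \in s -> depends (D y) (fun c => (H y c)%:R)) ->
  (forall y y' x, y != y' -> D y x -> ~ D y' x) ->
  (forall y, y \in s -> q <= E (fun c => (H y c)%:R)) ->
  increasing G ->
  coin_exp q s G <= E (fun c => G (fun y => (y \in s) && H y c)).
Proof.
move=> HE us q0 dH disj; elim: s us dH G => [|y s IH] /=.
  by move=> _ _ G _ _; rewrite (pe_cst HE).
move=> /andP[ys us] dH G qH incG.
set Gy := fun c : Y -> bool => G (fun z => (z == y) || c z).
have incGy : increasing Gy.
  by move=> A B AB; apply: incG => z /orP[->//|/AB->]; rewrite orbT.
set K := fun (F : (Y -> bool) -> R) c => F (fun z => (z \in s) && H z c).
have dK F : depends (fun x => exists2 z, z \in s & D z x) (K F).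
  move=> c c' e; congr F; apply/funext => z; case zs: (z \in s) => //=.
  have := dH z; rewrite inE zs orbT => /(_ isT c c').
  have sub x : D z x -> c x = c' x by move=> Dx; apply: e; exists z.
  by move=> /(_ sub); case: (H z c); case: (H z c') => // /eqP; rewrite ?oner_eq0 // eq_sym oner_eq0.
have dis x : D y x -> ~ exists2 z, z \in s & D z x.
  move=> Dy [z zs]; apply: disj Dy; apply: contraNneq ys => ->; exact: zs.
have IHs F : increasing F -> coin_exp q s F <= E (K F).
  move=> incF; apply: IH => //.
  - by move=> z zs; apply: dH; rewrite inE zs orbT.
  - by move=> z zs; apply: qH; rewrite inE zs orbT.
have dHy := dH y (mem_head _ _).
have qHy := qH y (mem_head _ _).
set h := fun c => (H y c)%:R : R.
(* The increment of [G] caused by [y] only involves the events of the points in [s], hence is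
   independent of [h]. *)
have -> : E (fun c => G (fun z => (z \in y :: s) && H z c)) =
  E (fun c => h c * (K Gy c - K G c)) + E (K G).
  rewrite -(peD HE); congr E; apply/funext => c; rewrite /h /K /Gy.
  case Hy: (H y c).
    rewrite mul1r subrK; congr G; apply/funext => z; rewrite inE.
    by case: eqP => [->|_] //=; rewrite Hy.
  rewrite mul0r add0r; congr G; apply/funext => z; rewrite inE.
  by case: eqP => [->|_] //=; rewrite Hy (negPf ys).
have dK2 : depends (fun x => exists2 z, z \in s & D z x) (fun c => K Gy c - K G c).
  by move=> c c' e; rewrite (dK Gy c c' e) (dK G c c' e).
rewrite (pe_indep2 HE dHy dK2 dis) (peB HE).
have KGG : E (K G) <= E (K Gy).
  by apply: (pe_le HE) => c; apply: incG => z ->; rewrite orbT.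
have h1 : E h <= 1 by apply: (pe_le1 HE) => c; rewrite /h; case: (H y c).
have := IHs _ incGy; have := IHs _ incG.
rewrite -/h in qHy *.
move=> i1 i2.
have q1 := le_trans qHy h1.
have : q * coin_exp q s Gy + (1 - q) * coin_exp q s G <= q * E (K Gy) + (1 - q) * E (K G).
  by apply: lerD; apply: ler_wpM2l; rewrite ?subr_ge0.
move=> /le_trans; apply; nra.
Qed.

End IndependentCoins.

Arguments coin_exp : simpl never.

(** * Families of open paths with disjoint coins *)

Definition sdisj (X : eqType) (s t : seq X) : Prop :=
  forall x, x \in s -> x \in t -> False.

Section Comb.
Context {R : realType} (X : eqType) (E : ((X -> bool) -> R) -> R).
Hypothesis HE : prodexp E.

Lemma depends_all (s : seq X) :
  depends (fun x => x \in s) (fun c => (all c s)%:R : R).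
Proof. by move=> c c' e; rewrite (eq_in_all e). Qed.

Lemma depends_has (I : eqType) (T : I -> seq X) (g : seq I) :
  depends (fun x => exists2 i, i \in g & x \in T i)
    (fun c => (has (fun i => all c (T i)) g)%:R : R).
Proof.
move=> c c' e; congr (_%:R); congr nat_of_bool.
apply: eq_in_has => i ig; apply: eq_in_all => x xT.
by apply: e; exists i.
Qed.

Lemma pe_all (w : X -> R) (s : seq X) : uniq s ->
  (forall x, x \in s -> E (fun c => (c x)%:R) = w x) ->
  E (fun c => (all c s)%:R) = \prod_(x <- s) w x.
Proof.
elim: s => [|x s IH] /=; first by rewrite big_nil (pe1 HE).
move=> /andP[xs us] hw; rewrite big_cons -IH //; last first.
  by move=> y ys; apply: hw; rewrite inE ys orbT.
rewrite -hw ?mem_head //.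
rewrite -(pe_indep2 HE (D := fun y => y == x) _ (@depends_all s)).
- by congr E; apply/funext => c; rewrite -natrM mulnb.
- by move=> c c' e; rewrite e.
- by move=> y /eqP ->; apply/negP.
Qed.

Lemma none_le (I : eqType) (T : I -> seq X) (g : seq I) b :
  0 <= b <= 1 -> uniq g ->
  (forall i, i \in g -> b <= E (fun c => (all c (T i))%:R)) ->
  (forall i j, i \in g -> j \in g -> i != j -> sdisj (T i) (T j)) ->
  E (fun c => (~~ has (fun i => all c (T i)) g)%:R) <= (1 - b) ^+ size g.
Proof.
move=> /andP[b0 b1]; elim: g => [|i g IH] /=; first by rewrite (pe1 HE) expr0.
move=> /andP[ig ug] hb dis.
have -> : (fun c : X -> bool => (~~ (all c (T i) || has (fun i => all c (T i)) g))%:R : R)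
  = (fun c => (1 - (all c (T i))%:R) * (~~ has (fun i => all c (T i)) g)%:R).
  by apply/funext => c; case: (all c _); case: (has _ _); rewrite /= ?subrr ?subr0 ?mul1r ?mul0r.
rewrite (pe_indep2 HE (D := fun x => x \in T i) (D' := fun x => exists2 i, i \in g & x \in T i)).
- rewrite exprS (peB HE) (pe1 HE); apply: ler_pM.
  + by rewrite subr_ge0; apply: (pe_le1 HE) => c; case: (all _ _).
  + by apply: (pe_ge0 HE) => c; case: (~~ _).
  + by rewrite lerD2l lerN2 hb ?mem_head.
  + apply: IH => //; first by move=> j jg; apply: hb; rewrite inE jg orbT.
    by move=> j k jg kg; apply: dis; rewrite inE ?jg ?kg orbT.
- by move=> c c' e; rewrite (depends_all e).
- move=> c c' e; have := depends_has e.
  by case: (has _ _); case: (has _ _) => //= /eqP; rewrite ?oner_eq0 // eq_sym oner_eq0.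
- move=> x xi [j jg xj]; apply: (dis i j) xi xj; rewrite ?mem_head ?inE ?jg ?orbT //.
  by apply: contraNneq ig => ->.
Qed.

(** Union bound over the groups, each of which fails with probability at most [(1 - b) ^+ s] by
    [none_le]. Teeth of different groups may share coins. *)
Lemma teeth_ge (I : eqType) (T : I -> seq X) (gs : seq (seq I)) b s :
  0 <= b <= 1 ->
  (forall g, g \in gs -> uniq g /\ size g = s) ->
  (forall g i, g \in gs -> i \in g -> b <= E (fun c => (all c (T i))%:R)) ->
  (forall g i j, g \in gs -> i \in g -> j \in g -> i != j -> sdisj (T i) (T j)) ->
  1 - (size gs)%:R * (1 - b) ^+ s <=
    E (fun c => (all (fun g => has (fun i => all c (T i)) g) gs)%:R).
Proof.
move=> b01; elim: gs => [|g gs IH] /=.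
  by rewrite mul0r subr0 (pe1 HE).
move=> hu hb dis.
have -> : 1 - (size gs).+1%:R * (1 - b) ^+ s =
  (1 - (size gs)%:R * (1 - b) ^+ s) - (1 - b) ^+ s by rewrite -natr1; ring.
have [ug sg] := hu g (mem_head _ _).
have h1 : E (fun c => (~~ has (fun i => all c (T i)) g)%:R) <= (1 - b) ^+ s.
  rewrite -sg; apply: none_le => //.
    by move=> i ig; apply: (hb g); rewrite ?mem_head.
  by move=> i j ig jg; apply: (dis g); rewrite ?mem_head.
have h2 : 1 - (size gs)%:R * (1 - b) ^+ s <=
    E (fun c => (all (fun g => has (fun i => all c (T i)) g) gs)%:R).
  apply: IH.
  - by move=> g' g'i; apply: hu; rewrite inE g'i orbT.
  - by move=> g' i g'i; apply: hb; rewrite inE g'i orbT.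
  - by move=> g' i j g'i; apply: dis; rewrite inE g'i orbT.
apply: (le_trans (lerB h2 h1)); rewrite -(peB HE); apply: (pe_le HE) => c.
by case: (has _ _); case: (all _ _) => //=; rewrite ?subrr ?subr0 ?sub0r // lerNl oppr0 ler01.
Qed.

(* Explore the mains in the order of [js]; the teeth of the first open main
   avoid all sites explored so far. *)
Lemma comb_ge (J I : eqType) (lt : rel J) (js : seq J) (M : J -> seq X)
    (T : J -> I -> seq X) (gs : seq (seq I)) (p tau : R) :
  0 <= p <= 1 -> 0 <= tau <= 1 -> pairwise lt js ->
  (forall j, j \in js -> p <= E (fun c => (all c (M j))%:R)) ->
  (forall j, j \in js ->
     tau <= E (fun c => (all (fun g => has (fun i => all c (T j i)) g) gs)%:R)) ->
  (forall j j', j \in js -> j' \in js -> lt j j' -> sdisj (M j) (M j')) ->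
  (forall j j' g i, j \in js -> j' \in js -> j = j' \/ lt j j' ->
     g \in gs -> i \in g -> sdisj (M j) (T j' i)) ->
  tau * (1 - (1 - p) ^+ size js) <=
  E (fun c => (has (fun j => all c (M j) &&
                 all (fun g => has (fun i => all c (T j i)) g) gs) js)%:R).
Proof.
move=> /andP[p0 p1] /andP[t0 t1]; elim: js => [|j js IH] /=.
  by rewrite expr0 subrr mulr0 (pe_cst HE).
move=> /andP[/allP jlt pjs] hp ht dMM dMT.
set F := fun j c => all c (M j) && all (fun g => has (fun i => all c (T j i)) g) gs.
set tt := fun c => (all (fun g => has (fun i => all c (T j i)) g) gs)%:R : R.
set m := fun c => (all c (M j))%:R : R.
set r := fun c => (has (fun j => F j c) js)%:R : R.
pose DT j' x := exists2 g, g \in gs & exists2 i, i \in g & x \in T j' i.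
have dtt j' : depends (DT j') (fun c => (all (fun g => has (fun i => all c (T j' i)) g) gs)%:R : R).
  move=> c c' e; congr (_%:R); congr nat_of_bool.
  apply: eq_in_all => g ggs; apply: eq_in_has => i ig; apply: eq_in_all => x xT.
  by apply: e; exists g => //; exists i.
pose DR x := exists2 j', j' \in js & x \in M j' \/ DT j' x.
have dr : depends DR r.
  move=> c c' e; rewrite /r; congr (_%:R); congr nat_of_bool.
  apply: eq_in_has => j' j'js; rewrite /F; congr andb.
    by apply: eq_in_all => x xM; apply: e; exists j' => //; left.
  apply: eq_in_all => g ggs; apply: eq_in_has => i ig; apply: eq_in_all => x xT.
  by apply: e; exists j' => //; right; exists g => //; exists i.
have mDR x : x \in M j -> ~ DR x.
  move=> xM [j' j'js [xM'|[g ggs [i ig xT]]]].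
    by apply: (dMM j j' (mem_head _ _) _ _ x xM xM'); rewrite ?inE ?j'js ?orbT // jlt.
  apply: (dMT j j' g i (mem_head _ _) _ _ _ _ x xM xT) => //.
    by rewrite inE j'js orbT.
  by right; apply: jlt.
have mDT x : x \in M j -> ~ DT j x.
  move=> xM [g ggs [i ig xT]].
  by apply: (dMT j j g i (mem_head _ _) _ _ _ _ x xM xT); rewrite ?mem_head //; left.
have IHr : tau * (1 - (1 - p) ^+ size js) <= E r.
  apply: IH => //.
  - by move=> k kjs; apply: hp; rewrite inE kjs orbT.
  - by move=> k kjs; apply: ht; rewrite inE kjs orbT.
  - by move=> k k' kjs k'js; apply: dMM; rewrite inE ?kjs ?k'js orbT.
  - by move=> k k' g i kjs k'js; apply: dMT; rewrite inE ?kjs ?k'js orbT.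
have dm := @depends_all (M j).
have dm' : depends (fun x => x \in M j) (fun c => 1 - m c).
  by move=> c c' e; rewrite /m (dm c c' e).
(* If the first main is open only its own teeth are tried; the later mains count only if it is
   closed. Thus [m] is multiplied by quantities that use other coins. *)
have key : E (fun c => m c * tt c + (1 - m c) * r c) <=
    E (fun c => (F j c || has (fun j => F j c) js)%:R).
  apply: (pe_le HE) => c; rewrite /m /tt /r /F.
  by case: (all c _); case: (all _ gs); case: (has _ js);
    rewrite /= ?subrr ?subr0 ?mul0r ?mul1r ?add0r ?addr0 ?lexx ?ler01.
apply: le_trans key.
rewrite (peD HE) (pe_indep2 HE dm (dtt j) mDT) (pe_indep2 HE dm' dr mDR).
rewrite (peB HE) (pe1 HE).
have e1 : p <= E m by apply: hp; rewrite mem_head.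
have e2 : tau <= E tt by apply: ht; rewrite mem_head.
have e3 : E m <= 1 by apply: (pe_le1 HE) => c; rewrite /m; case: (all _ _).
rewrite -/m.
set e := E m in e1 e3 *; set z := E tt in e2 *; set v := E r in IHr *.
have x0 : 0 <= (1 - p) ^+ size js by apply: exprn_ge0; lra.
rewrite exprS; set x := (1 - p) ^+ size js in x0 IHr *.
have h1 : e * tau <= e * z by apply: ler_wpM2l => //; lra.
have h2 : (1 - e) * (tau * (1 - x)) <= (1 - e) * v by apply: ler_wpM2l => //; lra.
have h3 : 0 <= tau * x * (e - p) by apply: mulr_ge0; [apply: mulr_ge0|lra].
apply: (le_trans _ (lerD h1 h2)); rewrite -subr_ge0.
by apply: (le_trans h3); rewrite le_eqVlt; apply/orP; left; apply/eqP; ring.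
Qed.

End Comb.

(** * Site percolation *)

Section SitePercolation.
Context {R : realType}.
Implicit Types (A B : int -> bool) (l pre : seq R) (M : nat).

(** Heights are cut off at [M], so that every expectation is a finite sum; [M] is later taken large
    in terms of the horizon. *)
Definition window M : seq int := [seq k%:Z - M%:Z | k <- iota 0 (2 * M).+1].

Lemma mem_window M y : (y \in window M) = (`|y| <= M%:Z).
Proof.
apply/mapP/idP => [[k]|yM]; first by rewrite mem_iota => /andP[_]; lia.
exists (absz (y + M%:Z)); last by lia.
by rewrite mem_iota; lia.
Qed.

Lemma window_uniq M : uniq (window M).
Proof. by rewrite map_inj_uniq ?iota_uniq // => i j; lia. Qed.

Definition next A (c : int -> bool) : int -> bool :=
  fun y => c y && (A y || A (y - 1)).

Lemma next_mono A B (c c' : int -> bool) : (forall y, A y -> B y) -> (forall y, c y -> c' y) ->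
  forall y, next A c y -> next B c' y.
Proof. by rewrite /next => AB cc' y /andP[/cc'-> /orP[/AB|/AB]] /= ->; rewrite ?orbT. Qed.

Fixpoint quenched_exp M l A (f : (int -> bool) -> R) : R :=
  if l is z :: l' then coin_exp z^-1 (window M) (fun c => quenched_exp M l' (next A c) f) else f A.

(* Coin [(t, y)] decides the site [y] at time [t + 1]. *)
Definition layer (c0 : int -> bool) (c : nat * int -> bool) : nat * int -> bool :=
  fun x => if x.1 is t.+1 then c (t, x.2) else c0 x.2.

(** All columns are drawn beforehand, so that events on disjoint sets of space-time points are
    independent. [quenched_exp] is the same process run column by column. *)
Fixpoint spacetime_exp M l (F : (nat * int -> bool) -> R) : R :=
  if l is z :: l' then coin_exp z^-1 (window M) (fun c0 => spacetime_exp M l' (fun c => F (layer c0 c)))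
  else F (fun _ => false).

Definition ge1 l := all (fun z => 1 <= z) l.

Definition lprod l : R := \prod_(z <- l) z.

Lemma inv01 (z : R) : 1 <= z -> 0 <= z^-1 <= 1.
Proof. by move=> z1; rewrite invr_ge0 (le_trans ler01 z1) invf_le1 // (lt_le_trans ltr01). Qed.

Lemma coin_expV_prodexp M (z : R) : 1 <= z -> prodexp (coin_exp z^-1 (window M)).
Proof. by move=> z1; apply: coin_exp_prodexp; apply: inv01. Qed.

Lemma spacetime_prodexp M l : ge1 l -> prodexp (spacetime_exp M l).
Proof.
elim: l => [|z l IH] /=.
  by move=> _; split => // D f g _ _.
move=> /andP[z1 /IH {IH}IH]; have Hz := coin_expV_prodexp M z1.
split.
- move=> f g /=; rewrite -(peD Hz). congr (coin_exp _ _ _); apply/funext => c.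
  by rewrite -(peD IH).
- move=> a f /=; rewrite -(peZ Hz); congr (coin_exp _ _ _); apply/funext => c.
  by rewrite -(peZ IH).
- by move=> f g fg /=; apply: (pe_le Hz) => c; apply: (pe_le IH).
- by rewrite -[RHS](pe1 Hz) /=; congr (coin_exp _ _ _); apply/funext => c; rewrite (pe1 IH).
- move=> D f g df dg /=.
  rewrite -(pe_indep Hz (D := fun y => D (0%N, y))).
  + congr (coin_exp _ _ _); apply/funext => c0.
    rewrite (pe_indep IH (D := fun x => D (x.1.+1, x.2))) //.
      by move=> c c' e; apply: df => -[[|t] y] Dx //=; apply: e.
    by move=> c c' e; apply: dg => -[[|t] y] Dx //=; apply: e.
  + move=> c c' e; congr (spacetime_exp _ _ _); apply/funext => c1.
    by apply: df => -[[|t] y] Dx //=; apply: e.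
  + move=> c c' e; congr (spacetime_exp _ _ _); apply/funext => c1.
    by apply: dg => -[[|t] y] Dx //=; apply: e.
Qed.

Lemma spacetime_site M l t y : ge1 l -> (t < size l)%N -> y \in window M ->
  spacetime_exp M l (fun c => (c (t, y))%:R) = (nth 1 l t)^-1.
Proof.
elim: l t => [|z l IH] [|t] //= /andP[z1 l1] tl yM.
  under eq_fun => c0 do rewrite (pe_cst (spacetime_prodexp M l1)).
  by rewrite /layer /= coin_exp_mem ?window_uniq.
under eq_fun => c0 do rewrite /layer /= IH //.
by rewrite (pe_cst (coin_expV_prodexp M z1)).
Qed.

Fixpoint occupied A (c : nat * int -> bool) t : int -> bool :=
  if t is t'.+1 then next (occupied A c t') (fun y => c (t', y)) else A.

Lemma occupied_layer A c0 (c : nat * int -> bool) t : occupied A (layer c0 c) t.+1 = occupied (next A c0) c t.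
Proof. by elim: t => // t IH; rewrite [LHS]/= -/(occupied A (layer c0 c) t.+1) IH. Qed.

Lemma quenched_spacetime M l A f : quenched_exp M l A f = spacetime_exp M l (fun c => f (occupied A c (size l))).
Proof.
elim: l A => //= z l IH A; congr (coin_exp _ _ _); apply/funext => c0.
by rewrite IH; congr (spacetime_exp _ _ _); apply/funext => c; rewrite -occupied_layer.
Qed.

Lemma quenched_cat M l l' A f : quenched_exp M (l ++ l') A f = quenched_exp M l A (fun B => quenched_exp M l' B f).
Proof. by elim: l A => //= z l IH A; congr (coin_exp _ _ _); apply/funext => c. Qed.

Lemma quenched_le M l A f g : ge1 l -> (forall B, f B <= g B) -> quenched_exp M l A f <= quenched_exp M l A g.
Proof.
move=> l1 fg; rewrite !quenched_spacetime; apply: (pe_le (spacetime_prodexp M l1)) => c; exact: fg.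
Qed.

Lemma quenched_increasing M l f : ge1 l -> increasing f -> increasing (quenched_exp M l ^~ f).
Proof.
elim: l => //= z l IH /andP[z1 l1] incf A B AB.
apply: (pe_le (coin_expV_prodexp M z1)) => c; apply: IH => // y.
exact: next_mono.
Qed.

Definition path_sites (pos : nat -> int) (a b : nat) : seq (nat * int) :=
  [seq (t, pos t.+1) | t <- iota a (b - a)].

Lemma mem_path_sites pos a b x :
  (x \in path_sites pos a b) = [&& (a <= x.1)%N, (x.1 < b)%N & x.2 == pos x.1.+1].
Proof.
apply/mapP/and3P => [[t]|].
  by rewrite mem_iota => tab -> /=; split => //; lia.
case: x => t y /= [at_ tb /eqP ->]; exists t => //.
by rewrite mem_iota; lia.
Qed.

Lemma path_sites_uniq pos a b : uniq (path_sites pos a b).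
Proof. by rewrite map_inj_uniq ?iota_uniq // => t t' []. Qed.

Lemma occupied_path A (c : nat * int -> bool) pos a b t :
  occupied A c a (pos a) -> all c (path_sites pos a b) ->
  (forall t, (a <= t < b)%N -> pos t.+1 = pos t \/ pos t.+1 = pos t + 1) ->
  (a <= t <= b)%N -> occupied A c t (pos t).
Proof.
move=> Aa /allP cs step; elim: t => [|t IH] tab.
  by have -> : 0%N = a by lia.
have [->//|ta] := eqVneq t.+1 a.
have /IH {IH}ot : (a <= t <= b)%N by lia.
rewrite /= /next; apply/andP; split.
  by apply: cs; rewrite mem_path_sites /=; apply/and3P; split => //; lia.
have [|->|->] := step t; [lia|by rewrite ot|by rewrite addrK ot orbT].
Qed.

Lemma ge1_cat l l' : ge1 (l ++ l') = ge1 l && ge1 l'.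
Proof. exact: all_cat. Qed.

Lemma lprod_cat l l' : lprod (l ++ l') = lprod l * lprod l'.
Proof. exact: big_cat. Qed.

Lemma lprod_ge1 l : ge1 l -> 1 <= lprod l.
Proof.
rewrite /lprod; elim: l => [|z l IH] /=; first by rewrite big_nil.
by move=> /andP[z1 /IH l1]; rewrite big_cons; apply: mulr_ege1.
Qed.

Lemma ge1_drop k l : ge1 l -> ge1 (drop k l).
Proof. by rewrite -{1}(cat_take_drop k l) ge1_cat => /andP[]. Qed.

Lemma ge1_take k l : ge1 l -> ge1 (take k l).
Proof. by rewrite -{1}(cat_take_drop k l) ge1_cat => /andP[]. Qed.

Lemma lprod_drop k l : ge1 l -> lprod (drop k l) <= lprod l.
Proof.
move=> l1; rewrite -[in leRHS](cat_take_drop k l) lprod_cat ler_peMl //.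
  by rewrite (le_trans ler01) // lprod_ge1 ?ge1_drop.
by rewrite lprod_ge1 ?ge1_take.
Qed.

Lemma lprod_take k l : ge1 l -> lprod (take k l) <= lprod l.
Proof.
move=> l1; rewrite -[in leRHS](cat_take_drop k l) lprod_cat ler_peMr //.
  by rewrite (le_trans ler01) // lprod_ge1 ?ge1_take.
by rewrite lprod_ge1 ?ge1_drop.
Qed.

(** A path uses one coin in each column from [a] to [b], so its probability is the inverse product
    of these columns; multiplying in the columns after [b] only weakens the bound. *)
Lemma spacetime_path_sites M l pos a b : ge1 l -> (b <= size l)%N ->
  (forall t, (a <= t < b)%N -> pos t.+1 \in window M) ->
  (lprod (drop a l))^-1 <= spacetime_exp M l (fun c => (all c (path_sites pos a b))%:R).
Proof.
move=> l1 bl posM.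
rewrite (pe_all (spacetime_prodexp M l1) (w := fun x => (nth 1 l x.1)^-1)); last 2 first.
- exact: path_sites_uniq.
- move=> [t y]; rewrite mem_path_sites /= => /and3P[at_ tb /eqP ->].
  by rewrite spacetime_site //; [exact: leq_trans bl|apply: posM; rewrite at_].
rewrite big_map /= prodfV lef_pV2 ?posrE; last 2 first.
- by rewrite (lt_le_trans ltr01) // lprod_ge1 ?ge1_drop.
- apply: prodr_gt0 => i _; apply: (lt_le_trans ltr01).
  by have [il|il] := ltnP i (size l); [exact: (allP l1 _ (mem_nth _ il))|rewrite nth_default].
have [ab|ba] := leqP a b; last first.
  have /eqP -> : (b - a == 0)%N by rewrite subn_eq0 ltnW.
  by rewrite big_nil lprod_ge1 ?ge1_drop.
rewrite -(big_map (nth 1 l) predT id) map_nth_iota; last exact: leq_sub2r.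
by rewrite -/(lprod _) lprod_take ?ge1_drop.
Qed.

End SitePercolation.

(** * Refilling a block *)

Section BlockCombs.
Context {R : realType}.
Variables (n s M : nat).
Implicit Types (A B : int -> bool) (c : nat * int -> bool) (l pre : seq R) (o : int).

Definition slots : seq (seq nat) := [seq iota (i * s) s | i <- iota 0 (2 * n)].

Lemma slotsP g : g \in slots -> uniq g /\ size g = s.
Proof. by move=> /mapP[i _ ->]; rewrite iota_uniq size_iota. Qed.

Lemma slots_lt g k : g \in slots -> k \in g -> (k < 2 * (n * s))%N.
Proof.
move=> /mapP[i]; rewrite mem_iota => /andP[_ ilt] ->; rewrite mem_iota.
rewrite add0n in ilt; move=> /andP[_ klt]; apply: (leq_trans klt).
by rewrite -mulSnr mulnA leq_mul2r ilt orbT.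
Qed.

Lemma size_slots : size slots = (2 * n)%N.
Proof. by rewrite size_map size_iota. Qed.

Definition filled (o : int) A : bool := all (has (fun k : nat => A (o + k%:Z))) slots.

Definition comb (js : seq nat) (P : nat -> seq (nat * int))
    (T : nat -> nat -> seq (nat * int)) c : bool :=
  has (fun j => all c (P j) && all (fun g => has (fun k => all c (T j k)) g) slots) js.

(** The bound of [teeth_ge] for [2 * n] slots of width [s] and teeth of probability at least
    [a^-1]. *)
Definition tau (a : R) : R := 1 - (2 * n)%:R * (1 - a^-1) ^+ s.

Definition tooth (T0 : nat) o (k t : nat) : int :=
  o + (n * s + k)%:Z + (t - (T0 + 3 * (n * s)))%:Z.

(* At time [t] the frame of the strip has been shifted by [t - (T0 + 3ns)]
   (truncated subtraction): it is at rest during the slow cells (length [T0]) and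
   the first half of the fine cell, and moves up by one per step in the second
   half.  Relative to the frame the strip is [0, 4ns), the target slots are
   [ns, 3ns), and the teeth stay put.  A main path starting in [0, ns) sweeps the
   target upwards in the first half; one starting in [3ns, 4ns) sweeps it
   downwards in the second half, by standing still. *)
Definition strip (T0 : nat) o (x : nat * int) : Prop :=
  o + (x.1.+1 - (T0 + 3 * (n * s)))%:Z <= x.2 <
  o + (x.1.+1 - (T0 + 3 * (n * s)))%:Z + (4 * (n * s))%:Z.

Definition up_main T0 (y : nat -> int) j : seq (nat * int) :=
  path_sites (fun t => y j + (t - T0)%:Z) 0 (T0 + 3 * (n * s)).
(** A tooth starts at the time when its main meets the line of slot point [k]. Here the main rises
    through resting lines; in [down_tooth] rising lines pass a standing main. *)
Definition up_tooth T0 o (y : nat -> int) j k : seq (nat * int) :=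
  path_sites (tooth T0 o k) (T0 + absz (o + (n * s + k)%:Z - y j)%R) (T0 + 6 * (n * s)).
Definition down_main T0 (y : nat -> int) j : seq (nat * int) :=
  path_sites (fun _ => y j) 0 (T0 + 6 * (n * s)).
Definition down_tooth T0 o (y : nat -> int) j k : seq (nat * int) :=
  path_sites (tooth T0 o k)
    (T0 + 3 * (n * s) + absz (y j - (o + (n * s + k)%:Z))%R) (T0 + 6 * (n * s)).

Lemma depends_comb js P T (D : nat * int -> Prop) :
  (forall j x, j \in js -> x \in P j -> D x) ->
  (forall j g k x, j \in js -> g \in slots -> k \in g -> x \in T j k -> D x) ->
  depends D (fun c => (comb js P T c)%:R : R).
Proof.
move=> DP DT c c' e; congr (_%:R); congr nat_of_bool.
apply: eq_in_has => j jjs; congr andb.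
  by apply: eq_in_all => x /(DP _ _ jjs)/e.
apply: eq_in_all => g gs; apply: eq_in_has => k kg; apply: eq_in_all => x xT.
by apply: e; exact: (DT j g k x).
Qed.

(** A main may cross [pre] as well as [l], hence its cost [lprod pre * a]; the teeth stay inside the
    fine cell [l] and cost at most [a]. *)
Lemma comb_prob (lt : rel nat) pre l (a : R) js P T :
  ge1 pre -> ge1 l -> lprod l <= a -> 0 <= tau a -> pairwise lt js ->
  (forall j, j \in js -> exists pos b, [/\ P j = path_sites pos 0 b,
     (b <= size pre + size l)%N & forall t, (t < b)%N -> pos t.+1 \in window M]) ->
  (forall j g k, j \in js -> g \in slots -> k \in g ->
     exists pos b, [/\ T j k = path_sites pos (size pre + b) (size pre + size l) &
     forall t, (size pre + b <= t < size pre + size l)%N -> pos t.+1 \in window M]) ->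
  (forall j g k k', j \in js -> g \in slots -> k \in g -> k' \in g -> k != k' ->
    sdisj (T j k) (T j k')) ->
  (forall j j', j \in js -> j' \in js -> lt j j' -> sdisj (P j) (P j')) ->
  (forall j j' g i, j \in js -> j' \in js -> j = j' \/ lt j j' ->
     g \in slots -> i \in g -> sdisj (P j) (T j' i)) ->
  tau a * (1 - (1 - (lprod pre * a)^-1) ^+ size js) <=
    spacetime_exp M (pre ++ l) (fun c => (comb js P T c)%:R).
Proof.
move=> pre1 l1 la tau0 js_lt HP HT dTT dPP dPT.
have HE : prodexp (spacetime_exp M (pre ++ l)) by apply: spacetime_prodexp; rewrite ge1_cat pre1.
have a1 : 1 <= a by apply: le_trans la; exact: lprod_ge1.
have a0 : 0 < a by apply: lt_le_trans a1.
have pa1 : 1 <= lprod pre * a by apply: mulr_ege1 => //; exact: lprod_ge1.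
apply: (comb_ge HE _ _ js_lt) => //.
- exact: inv01.
- rewrite tau0 /tau lerBlDr lerDl mulr_ge0 ?ler0n // exprn_ge0 // subr_ge0.
  by have /andP[] := inv01 a1.
- move=> j /HP[pos [b [-> bs posM]]].
  have := @spacetime_path_sites R M (pre ++ l) pos 0 b.
  rewrite ge1_cat pre1 l1 size_cat drop0 lprod_cat => /(_ isT bs posM); apply: le_trans.
  have p0 : 0 < lprod pre by rewrite (lt_le_trans ltr01) ?lprod_ge1.
  rewrite lef_pV2 ?posrE ?mulr_gt0 // ?(lt_le_trans ltr01) ?lprod_ge1 //.
  by rewrite ler_pM2l.
- move=> j jjs; rewrite /tau -size_slots; apply: (teeth_ge HE).
  + exact: inv01.
  + exact: slotsP.
  + move=> g k gs kg; have [pos [b [-> posM]]] := HT j g k jjs gs kg.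
    have := @spacetime_path_sites R M (pre ++ l) pos (size pre + b) (size pre + size l).
    rewrite ge1_cat pre1 l1 size_cat => /(_ isT (leqnn _) posM); apply: le_trans.
    have -> : drop (size pre + b) (pre ++ l) = drop b l.
      by rewrite drop_cat ltnNge leq_addr /= addKn.
    rewrite lef_pV2 ?posrE //; first exact: le_trans (lprod_drop _ _) la.
    by rewrite (lt_le_trans ltr01) ?lprod_ge1 ?ge1_drop.
  + by move=> g k k' gs kg k'g; apply: (dTT j g).
Qed.

Lemma tooth_disj T0 o k k' a b a' b' : k != k' ->
  sdisj (path_sites (tooth T0 o k) a b) (path_sites (tooth T0 o k') a' b').
Proof.
move=> kk' [t y]; rewrite !mem_path_sites /tooth /= => /and3P[_ _ /eqP ->] /and3P[_ _ /eqP].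
by move=> e; case/eqP: kk'; lia.
Qed.

Lemma tooth_step T0 o k t :
  tooth T0 o k t.+1 = tooth T0 o k t \/ tooth T0 o k t.+1 = tooth T0 o k t + 1.
Proof. by rewrite /tooth; lia. Qed.

Section Up.
Variables (T0 : nat) (o : int) (y : nat -> int) (js : seq nat) (A : int -> bool).
Hypotheses (jsA : forall j, j \in js -> A (y j))
  (jsy : forall j, j \in js -> o <= y j < o + (n * s)%:Z).

Definition up := comb js (up_main T0 y) (up_tooth T0 o y).

Lemma up_filled c : up c -> filled (o + (4 * (n * s))%:Z) (occupied A c (T0 + 6 * (n * s))).
Proof.
move=> /hasP[j jjs /andP[cM /allP cT]]; apply/allP => g gs.
have /hasP[k kg ck] := cT g gs; apply/hasP; exists k => //.
have klt := slots_lt gs kg.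
have /andP[y1 y2] := jsy jjs.
set r := (T0 + absz (o + (n * s + k)%:Z - y j)%R)%N.
have hr : occupied A c r (tooth T0 o k r).
  have -> : tooth T0 o k r = y j + (r - T0)%:Z by rewrite /tooth /r; lia.
  apply: (occupied_path (pos := fun t => y j + (t - T0)%:Z) _ cM).
  - by rewrite /= sub0n addr0; apply: jsA.
  - by move=> t _; lia.
  - by rewrite /r; lia.
have := @occupied_path A c (tooth T0 o k) r (T0 + 6 * (n * s)) (T0 + 6 * (n * s)) hr ck.
have -> : tooth T0 o k (T0 + 6 * (n * s)) = o + (4 * (n * s))%:Z + k%:Z by rewrite /tooth; lia.
apply; first by move=> t _; exact: tooth_step.
by rewrite /r; lia.
Qed.

Lemma depends_up : depends (strip T0 o) (fun c => (up c)%:R : R).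
Proof.
apply: depends_comb => [j [t z] jjs|j g k [t z] jjs gs kg]; rewrite mem_path_sites /strip /=.
  by have := jsy jjs; move=> /andP[y1 y2] /andP[t1 /eqP ->]; lia.
have klt := slots_lt gs kg.
by have := jsy jjs; move=> /andP[y1 y2] /and3P[t1 t2 /eqP ->]; rewrite /tooth; lia.
Qed.

Lemma up_prob pre l (a : R) : T0 = size pre -> size l = (6 * (n * s))%N ->
  ge1 pre -> ge1 l -> lprod l <= a -> 0 <= tau a ->
  pairwise (fun j j' => y j' < y j) js ->
  - M%:Z <= o -> o + (8 * (n * s))%:Z <= M%:Z ->
  tau a * (1 - (1 - (lprod pre * a)^-1) ^+ size js) <=
    spacetime_exp M (pre ++ l) (fun c => (up c)%:R).
Proof.
move=> eT sl pre1 l1 la tau0 jslt oM1 oM2.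
apply: (comb_prob pre1 l1 la tau0 jslt); rewrite -?eT ?sl.
- move=> j jjs; exists (fun t => y j + (t - T0)%:Z), (T0 + 3 * (n * s))%N; split => //.
    by lia.
  by move=> t tT; rewrite mem_window; have := jsy jjs; move=> /andP[y1 y2]; lia.
- move=> j g k jjs gs kg; have klt := slots_lt gs kg.
  exists (tooth T0 o k), (absz (o + (n * s + k)%:Z - y j)%R); split => //.
  by move=> t tT; rewrite mem_window /tooth; have := jsy jjs; move=> /andP[y1 y2]; lia.
- by move=> j g k k' jjs gs kg k'g kk'; apply: tooth_disj.
- move=> j j' jjs j'js lt [t z]; rewrite !mem_path_sites /=.
  by move=> /andP[t1 /eqP ->] /andP[t2 /eqP]; lia.
(* Mains are explored from the top down: the higher main [j] has crossed the line of slot point [k]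
   by the time the tooth of [j'] leaves along it. *)
- move=> j j' g k jjs j'js jj' gs kg [t z]; rewrite !mem_path_sites /= /tooth.
  have klt := slots_lt gs kg.
  have yy : y j' <= y j by case: jj' => [->//|/ltW].
  have := jsy jjs; have := jsy j'js; move=> /andP[y1 y2] /andP[y3 y4].
  by move=> /andP[t1 /eqP ->] /and3P[t2 t3 /eqP]; lia.
Qed.

End Up.

Section Down.
Variables (T0 : nat) (o : int) (y : nat -> int) (js : seq nat) (A : int -> bool).
Hypotheses (jsA : forall j, j \in js -> A (y j))
  (jsy : forall j, j \in js -> o + (3 * (n * s))%:Z <= y j < o + (4 * (n * s))%:Z).

Definition down := comb js (down_main T0 y) (down_tooth T0 o y).

Lemma down_filled c : down c -> filled (o + (4 * (n * s))%:Z) (occupied A c (T0 + 6 * (n * s))).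
Proof.
move=> /hasP[j jjs /andP[cM /allP cT]]; apply/allP => g gs.
have /hasP[k kg ck] := cT g gs; apply/hasP; exists k => //.
have klt := slots_lt gs kg.
have /andP[y1 y2] := jsy jjs.
set r := (T0 + 3 * (n * s) + absz (y j - (o + (n * s + k)%:Z))%R)%N.
have hr : occupied A c r (tooth T0 o k r).
  have -> : tooth T0 o k r = y j by rewrite /tooth /r; lia.
  apply: (occupied_path (pos := fun t => y j) _ cM).
  - by apply: jsA.
  - by left.
  - by rewrite /r; lia.
have := @occupied_path A c (tooth T0 o k) r (T0 + 6 * (n * s)) (T0 + 6 * (n * s)) hr ck.
have -> : tooth T0 o k (T0 + 6 * (n * s)) = o + (4 * (n * s))%:Z + k%:Z by rewrite /tooth; lia.
apply; first by move=> t _; exact: tooth_step.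
by rewrite /r; lia.
Qed.

Lemma depends_down : depends (strip T0 o) (fun c => (down c)%:R : R).
Proof.
apply: depends_comb => [j [t z] jjs|j g k [t z] jjs gs kg]; rewrite mem_path_sites /strip /=.
  by have := jsy jjs; move=> /andP[y1 y2] /andP[t1 /eqP ->]; lia.
have klt := slots_lt gs kg.
by have := jsy jjs; move=> /andP[y1 y2] /and3P[t1 t2 /eqP ->]; rewrite /tooth; lia.
Qed.

Lemma down_prob pre l (a : R) : T0 = size pre -> size l = (6 * (n * s))%N ->
  ge1 pre -> ge1 l -> lprod l <= a -> 0 <= tau a ->
  pairwise (fun j j' => y j < y j') js ->
  - M%:Z <= o -> o + (8 * (n * s))%:Z <= M%:Z ->
  tau a * (1 - (1 - (lprod pre * a)^-1) ^+ size js) <=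
    spacetime_exp M (pre ++ l) (fun c => (down c)%:R).
Proof.
move=> eT sl pre1 l1 la tau0 jslt oM1 oM2.
apply: (comb_prob pre1 l1 la tau0 jslt); rewrite -?eT ?sl.
- move=> j jjs; exists (fun t => y j), (T0 + 6 * (n * s))%N; split => //.
  by move=> t tT; rewrite mem_window; have := jsy jjs; move=> /andP[y1 y2]; lia.
- move=> j g k jjs gs kg; have klt := slots_lt gs kg.
  exists (tooth T0 o k), (3 * (n * s) + absz (y j - (o + (n * s + k)%:Z))%R)%N; split.
    by rewrite /down_tooth addnA.
  by move=> t tT; rewrite mem_window /tooth; have := jsy jjs; move=> /andP[y1 y2]; lia.
- by move=> j g k k' jjs gs kg k'g kk'; apply: tooth_disj.
- move=> j j' jjs j'js lt [t z]; rewrite !mem_path_sites /=.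
  by move=> /andP[t1 /eqP ->] /andP[t2 /eqP]; lia.
(* Here the order is from the bottom up: a rising line meets the lower main [j] first and is already
   above it when the tooth of [j'] starts. *)
- move=> j j' g k jjs j'js jj' gs kg [t z]; rewrite !mem_path_sites /= /tooth.
  have klt := slots_lt gs kg.
  have yy : y j <= y j' by case: jj' => [->//|/ltW].
  have := jsy jjs; have := jsy j'js; move=> /andP[y1 y2] /andP[y3 y4].
  by move=> /andP[t1 /eqP ->] /and3P[t2 t3 /eqP]; lia.
Qed.

End Down.

End BlockCombs.

Lemma pairwise_rev (T : Type) (r : rel T) (s : seq T) :
  pairwise r (rev s) = pairwise (fun x y => r y x) s.
Proof.
elim: s => //= x s IH.
by rewrite rev_cons pairwise_rcons all_rev IH.
Qed.

(** * One step of the coarse model *)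

Section BlockStep.
Context {R : realType}.
Variables (n s : nat).
Implicit Types (A B : int -> bool) (l pre : seq R) (o d J : int).

(* The block [J] at offset [d] is [d + 4nsJ, d + 4nsJ + 2ns). *)
Definition coarse d A : int -> bool :=
  fun J => filled n s (d + (4 * (n * s))%:Z * J) A.

(* The junk value [o] is taken when the slot is empty. *)
Definition slot_point o A i : int :=
  o + (head 0%N [seq k <- iota (i * s) s | A (o + k%:Z)])%:Z.

Lemma slot_pointP o A i : filled n s o A -> (i < 2 * n)%N ->
  A (slot_point o A i) /\
  o + (i * s)%:Z <= slot_point o A i < o + (i.+1 * s)%:Z.
Proof.
move=> /allP fA i2n.
have /fA : iota (i * s) s \in slots n s by apply/mapP; exists i; rewrite ?mem_iota.
rewrite has_filter /slot_point.
set t := seq.filter _ _; case e : t => [//|k t'] _ /=.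
have : k \in t by rewrite e mem_head.
rewrite mem_filter mem_iota => /andP[-> /andP[h1 h2]]; split => //.
by rewrite lerD2l lez_nat h1 ltrD2l ltz_nat mulSnr.
Qed.

Lemma slot_point_lt o A i j : filled n s o A -> (i < j < 2 * n)%N ->
  slot_point o A i < slot_point o A j.
Proof.
move=> fA /andP[ij jn].
have [_ /andP[_ h1]] := slot_pointP fA (ltn_trans ij jn).
have [_ /andP[h2 _]] := slot_pointP fA jn.
apply: (lt_le_trans h1); apply: le_trans h2.
by rewrite lerD2l lez_nat leq_mul2r ij orbT.
Qed.

(* The strip of the target [J] consists of the upper half of the block [J - 1], a
   gap and the lower half of the block [J], so distinct targets use disjoint sets
   of coins. *)
Lemma block_step M M' pre l A d (g : (int -> bool) -> R) a q :
  ge1 pre -> ge1 l -> size l = (6 * (n * s))%N -> lprod l <= a ->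
  0 <= tau n s a -> `|d| + (4 * (n * s) * (M' + 2))%:Z <= M%:Z ->
  increasing g -> 0 <= q ->
  q <= tau n s a * (1 - (1 - (lprod pre * a)^-1) ^+ n) ->
  coin_exp q (window M') (fun c => g (next (coarse d A) c)) <=
  quenched_exp M (pre ++ l) A (fun B => g (coarse (d + (n * s)%:Z) B)).
Proof.
move=> pre1 l1 sl la tau0 dM incg q0 qle.
have pl1 : ge1 (pre ++ l) by rewrite ge1_cat pre1.
have HE := @spacetime_prodexp R M _ pl1.
pose o J := d + (4 * (n * s))%:Z * J - (3 * (n * s))%:Z.
pose T0 := size pre.
pose yd J := slot_point (d + (4 * (n * s))%:Z * J) A.
pose yu J := slot_point (d + (4 * (n * s))%:Z * (J - 1)) A.
(* When neither block [J] nor [J - 1] is filled, the value [true] is a harmless default: [next]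
   ignores the coin of such a [J], and the event has probability 1. *)
pose H J c := if coarse d A J then down n s T0 (o J) (yd J) (iota 0 n) c
  else if coarse d A (J - 1) then up n s T0 (o J) (yu J) (rev (iota n n)) c else true.
have ydP J j : coarse d A J -> j \in iota 0 n -> A (yd J j) /\
    o J + (3 * (n * s))%:Z <= yd J j < o J + (4 * (n * s))%:Z.
  move=> fJ; rewrite mem_iota => /andP[_ jn]; rewrite add0n in jn.
  have [|Ay /andP[y1 y2]] := slot_pointP fJ (i := j); first by lia.
  rewrite -/(yd J j) in Ay y1 y2; split => //.
  have h : (j.+1 * s <= n * s)%N by rewrite leq_mul2r jn orbT.
  by rewrite /o; lia.
have yuP J j : coarse d A (J - 1) -> j \in rev (iota n n) -> A (yu J j) /\
    o J <= yu J j < o J + (n * s)%:Z.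
  move=> fJ; rewrite mem_rev mem_iota => /andP[nj jn].
  have [|Ay /andP[y1 y2]] := slot_pointP fJ (i := j); first by lia.
  rewrite -/(yu J j) in Ay y1 y2; split => //.
  have h : (j.+1 * s <= (n + n) * s)%N by rewrite leq_mul2r jn orbT.
  have h' : (n * s <= j * s)%N by rewrite leq_mul2r nj orbT.
  rewrite mulnDl in h; move: y1 y2; rewrite mulrBr mulr1 /o; lia.
have fill J c : J \in window M' -> H J c -> coarse d A J || coarse d A (J - 1) ->
    coarse (d + (n * s)%:Z) (occupied A c (size (pre ++ l))) J.
  move=> _; rewrite /H size_cat sl.
  (* The frame has risen by [3 * (n * s)] and the target lies [n * s] above its base, so the grid of
     blocks moves up by [n * s] in each coarse step. *)
  have oE : d + (n * s)%:Z + (4 * (n * s))%:Z * J = o J + (4 * (n * s))%:Z.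
    by rewrite /o; lia.
  rewrite /coarse oE.
  case: ifP => [fJ dn _|_].
    exact: (down_filled (fun j h => (ydP J j fJ h).1) (fun j h => (ydP J j fJ h).2)).
  case: ifP => [fJ dn _|//].
  exact: (up_filled (fun j h => (yuP J j fJ h).1) (fun j h => (yuP J j fJ h).2)).
rewrite quenched_spacetime.
pose G := fun c : int -> bool => g (next (coarse d A) c).
have incG : increasing G.
  by move=> c c' cc'; apply: incg => y; apply: next_mono.
apply: (@le_trans _ _ (spacetime_exp M (pre ++ l) (fun c => G (fun J => (J \in window M') && H J c)))).
  apply: (dominate (D := fun J => strip n s T0 (o J)) HE) => //.
  - exact: window_uniq.
  - move=> J _; rewrite /H; case fJ: (coarse d A J).
      by apply: depends_down => j h; exact: (ydP J j fJ h).2.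
    case fJ': (coarse d A (J - 1)); last by move=> c c' _.
    by apply: depends_up => j h; exact: (yuP J j fJ' h).2.
  - move=> J J' [t y]; rewrite /strip /= /o => JJ' /andP[h1 h2] /andP[h3 h4].
    have [lt|lt|e] := ltgtP J J'; last by rewrite e eqxx in JJ'.
      have : (4 * (n * s))%:Z * (J + 1) <= (4 * (n * s))%:Z * J'.
        by apply: ler_wpM2l; lia.
      by rewrite mulrDr mulr1; lia.
    have : (4 * (n * s))%:Z * (J' + 1) <= (4 * (n * s))%:Z * J.
      by apply: ler_wpM2l; lia.
    by rewrite mulrDr mulr1; lia.
  - move=> J; rewrite mem_window => JM.
    have oM : - M%:Z <= o J /\ o J + (8 * (n * s))%:Z <= M%:Z.
      have : `|(4 * (n * s))%:Z * J| <= (4 * (n * s) * M')%:Z.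
        by rewrite normrM (PoszM (4 * (n * s)) M') ger0_norm //; apply: ler_wpM2l.
      move: dM; rewrite mulnDr /o; lia.
    case: oM => oM1 oM2.
    apply: (le_trans qle); rewrite /H; case fJ: (coarse d A J).
      rewrite -[in X in _ ^+ X](size_iota 0 n); apply: (down_prob (M := M)) => //.
      + by move=> j h; exact: (ydP J j fJ h).2.
      + apply: (@sub_in_pairwise _ (mem (iota 0 n)) ltn).
        * move=> i j; rewrite !mem_iota !add0n => /andP[_ i_n] /andP[_ j_n] ij.
          by apply: slot_point_lt => //; lia.
        * by apply/allP.
        * by rewrite -(sorted_pairwise ltn_trans) iota_ltn_sorted.
    case fJ': (coarse d A (J - 1)).
      rewrite -[in X in _ ^+ X](size_iota n n) -[in X in _ ^+ X](size_rev (iota n n)); apply: (up_prob (M := M)) => //.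
      + by move=> j h; exact: (yuP J j fJ' h).2.
      + rewrite pairwise_rev.
        apply: (@sub_in_pairwise _ (mem (iota n n)) ltn).
        * move=> i j; rewrite !mem_iota => /andP[_ i_n] /andP[_ j_n] ij.
          by apply: slot_point_lt => //; lia.
        * by apply/allP.
        * by rewrite -(sorted_pairwise ltn_trans) iota_ltn_sorted.
    rewrite (pe1 HE).
    have a1 : 1 <= a by apply: le_trans la; exact: lprod_ge1.
    have pa1 : 1 <= lprod pre * a by apply: mulr_ege1 => //; exact: lprod_ge1.
    have /andP[h1 h2] := inv01 pa1; have /andP[h3 h4] := inv01 a1.
    apply: mulr_ile1 => //.
    + by rewrite subr_ge0 exprn_ile1 // ?subr_ge0 // lerBlDr lerDl.
    + by rewrite /tau lerBlDr lerDl mulr_ge0 ?ler0n // exprn_ge0 // subr_ge0.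
    + by rewrite lerBlDr lerDl exprn_ge0 // subr_ge0.
apply: (pe_le HE) => c; apply: incg => J /andP[/andP[JM HJ] or].
exact: fill.
Qed.

End BlockStep.

(** * Annealed survival and renormalization *)

Section Annealed.
Context {R : realType}.
Implicit Types (A B : int -> bool) (l pre : seq R) (o d J : int).
Implicit Types (f g : R -> R) (F G : seq R -> R).

(* Laws are finitely supported truncations, hence only sub-probabilities. *)
Record law (mu : (R -> R) -> R) : Prop := Law {
  lawD : forall f g, mu (fun z => f z + g z) = mu f + mu g;
  lawZ : forall a f, mu (fun z => a * f z) = a * mu f;
  law_le : forall f g, (forall z, 1 <= z -> f z <= g z) -> mu f <= mu g;
  law_mass : mu (fun _ => 1) <= 1 }.

Definition alive A : R := `[< exists y, A y >]%:R.

Lemma alive_increasing : increasing alive.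
Proof.
move=> A B AB; rewrite /alive ler_nat; case: asboolP => // -[y Ay].
by case: asboolP => // -[]; exists y; apply: AB.
Qed.

Lemma alive01 A : 0 <= alive A <= 1.
Proof. by rewrite /alive; case: asboolP; rewrite ?lexx ?ler01. Qed.

Lemma next_alive_le M A (z : R) : 1 <= z ->
  coin_exp z^-1 (window M) (fun c => alive (next A c)) <= alive A.
Proof.
move=> z1; have HE := coin_expV_prodexp M z1; rewrite -[leRHS](pe_cst HE).
apply: (pe_le HE) => c; rewrite /alive ler_nat.
case: asboolP => // -[y /andP[_ Ay]]; case: asboolP => // -[].
by case/orP: Ay => Ay; eexists; exact: Ay.
Qed.

Section Law.
Variables (mu : (R -> R) -> R).
Hypothesis hmu : law mu.

Lemma law_cst a : mu (fun _ => a) = a * mu (fun _ => 1).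
Proof. by rewrite -(lawZ hmu); congr mu; apply/funext => z; rewrite mulr1. Qed.

Lemma law_ge0 f : (forall z, 1 <= z -> 0 <= f z) -> 0 <= mu f.
Proof. by move=> f0; rewrite -(mul0r (mu (fun _ => 1))) -law_cst; apply: (law_le hmu). Qed.

Lemma law_le1 f : (forall z, 1 <= z -> f z <= 1) -> mu f <= 1.
Proof. by move=> f1; apply: le_trans (law_mass hmu); apply: (law_le hmu). Qed.

Fixpoint iid_exp r F : R :=
  if r is r'.+1 then mu (fun z => iid_exp r' (fun l => F (z :: l))) else F [::].

Lemma iid_expD r F G : iid_exp r (fun l => F l + G l) = iid_exp r F + iid_exp r G.
Proof.
elim: r F G => //= r IH F G; rewrite -(lawD hmu); congr mu; apply/funext => z; exact: IH.
Qed.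

Lemma iid_expZ r a F : iid_exp r (fun l => a * F l) = a * iid_exp r F.
Proof.
elim: r F => //= r IH F; rewrite -(lawZ hmu); congr mu; apply/funext => z; exact: IH.
Qed.

Lemma iid_exp_le r F G : (forall l, size l = r -> ge1 l -> F l <= G l) -> iid_exp r F <= iid_exp r G.
Proof.
elim: r F G => [|r IH] F G FG /=; first exact: FG.
apply: (law_le hmu) => z z1; apply: IH => l lr l1; apply: FG => /=; first by rewrite lr.
by rewrite z1.
Qed.

Lemma iid_exp_ge0 r F : (forall l, ge1 l -> 0 <= F l) -> 0 <= iid_exp r F.
Proof.
elim: r F => [|r IH] F F0 /=; first exact: F0.
by apply: law_ge0 => z z1; apply: IH => l l1; apply: F0; rewrite /= z1.
Qed.

Lemma iid_exp_le1 r F : (forall l, ge1 l -> F l <= 1) -> iid_exp r F <= 1.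
Proof.
elim: r F => [|r IH] F F0 /=; first exact: F0.
by apply: law_le1 => z z1; apply: IH => l l1; apply: F0; rewrite /= z1.
Qed.

Lemma coin_exp_law (X : eqType) q (s : seq X) (F : (X -> bool) -> R -> R) :
  coin_exp q s (fun c => mu (F c)) = mu (fun z => coin_exp q s (fun c => F c z)).
Proof.
elim: s F => // x s IH F.
rewrite coin_exp_cons IH (IH F).
by rewrite -!(lawZ hmu) -(lawD hmu).
Qed.

Lemma coin_exp_iid_exp (X : eqType) q (s : seq X) r (F : (X -> bool) -> seq R -> R) :
  coin_exp q s (fun c => iid_exp r (F c)) = iid_exp r (fun l => coin_exp q s (fun c => F c l)).
Proof.
by elim: r F => //= r IH F; rewrite coin_exp_law; congr mu; apply/funext => z.
Qed.

Lemma quenched_iid_exp M l A r (F : (int -> bool) -> seq R -> R) :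
  quenched_exp M l A (fun B => iid_exp r (F B)) = iid_exp r (fun l' => quenched_exp M l A (fun B => F B l')).
Proof.
elim: l A => //= z l IH A.
apply: etrans _ (coin_exp_iid_exp _ _ _ (fun c l' => quenched_exp M l (next A c) (fun B => F B l'))); congr (coin_exp _ _ _).
by apply/funext => c.
Qed.

Section Survival.
Variable M : nat.

Fixpoint survival N A : R :=
  if N is N'.+1 then mu (fun z => coin_exp z^-1 (window M) (fun c => survival N' (next A c)))
  else alive A.

Lemma survival_ge0 N A : 0 <= survival N A.
Proof.
elim: N A => [|N IH] A /=; first by have /andP[] := alive01 A.
by apply: law_ge0 => z z1; apply: (pe_ge0 (coin_expV_prodexp M z1)).
Qed.

Lemma survival_increasing N : increasing (survival N).
Proof.
elim: N => [|N IH] A B AB; first exact: alive_increasing.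
apply: (law_le hmu) => z z1; apply: (pe_le (coin_expV_prodexp M z1)) => c.
by apply: IH => y; apply: next_mono.
Qed.

Lemma survival_step N A : survival N.+1 A <= survival N A.
Proof.
elim: N A => [|N IH] A.
  apply: (@le_trans _ _ (mu (fun _ => alive A))).
    by apply: (law_le hmu) => z z1; exact: next_alive_le.
  by rewrite law_cst ler_piMr ?(law_mass hmu) //; have /andP[] := alive01 A.
apply: (law_le hmu) => z z1; apply: (pe_le (coin_expV_prodexp M z1)) => c; exact: IH.
Qed.

Lemma survival_le N N' A : (N <= N')%N -> survival N' A <= survival N A.
Proof.
move=> /subnK <-; elim: (N' - N)%N => // k IH.
by rewrite addSn; apply: le_trans IH; exact: survival_step.
Qed.

Lemma survival_addn r N A : survival (r + N) A = iid_exp r (fun l => quenched_exp M l A (survival N)).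
Proof.
elim: r A => //= r IH A; congr mu; apply/funext => z.
apply: etrans _ (coin_exp_iid_exp _ _ _ (fun c l => quenched_exp M l (next A c) (survival N))).
by congr (coin_exp _ _ _); apply/funext => c; rewrite IH.
Qed.

(** The subtraction is truncated: for [N < r] the left side asks for survival up to time [r], which
    is more. *)
Lemma survival_cell r N A : iid_exp r (fun l => quenched_exp M l A (survival (N - r))) <= survival N A.
Proof. by rewrite -survival_addn; apply: survival_le; rewrite -leq_subLR. Qed.

End Survival.

(* A coarse column is a run of at most [k] cells whose product exceeds [a],
   closed by the first cell whose product does not. *)
Fixpoint word_exp r (a : R) k pre (Phi : seq R -> seq R -> R) : R :=
  iid_exp r (fun l => if lprod l <= a then Phi pre l else
    if k is k'.+1 then word_exp r a k' (pre ++ l) Phi else 0).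

Lemma word_exp_le r a k pre (Phi Psi : seq R -> seq R -> R) : ge1 pre ->
  (forall p l, ge1 p -> ge1 l -> size l = r -> lprod l <= a -> Phi p l <= Psi p l) ->
  word_exp r a k pre Phi <= word_exp r a k pre Psi.
Proof.
move=> pre1 PP; elim: k pre pre1 => [|k IH] pre pre1; apply: iid_exp_le => l lr l1;
  case: ifP => la //; try exact: PP.
by apply: IH; rewrite ge1_cat pre1.
Qed.

Lemma word_expD r a k pre (Phi Psi : seq R -> seq R -> R) :
  word_exp r a k pre (fun p l => Phi p l + Psi p l) = word_exp r a k pre Phi + word_exp r a k pre Psi.
Proof.
elim: k pre => [|k IH] pre /=; rewrite -iid_expD; congr iid_exp; apply/funext => l;
  by case: ifP => // _; rewrite ?addr0 ?IH.
Qed.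

Lemma word_expZ r a k pre b (Phi : seq R -> seq R -> R) :
  word_exp r a k pre (fun p l => b * Phi p l) = b * word_exp r a k pre Phi.
Proof.
elim: k pre => [|k IH] pre /=; rewrite -iid_expZ; congr iid_exp; apply/funext => l;
  by case: ifP => // _; rewrite ?mulr0 ?IH.
Qed.

Lemma word_exp_le1 r a k pre : word_exp r a k pre (fun _ _ => 1) <= 1.
Proof.
elim: k pre => [|k IH] pre; apply: iid_exp_le1 => l l1; case: ifP => // _; exact: ler01.
Qed.

(** Every run contains at least one cell, so at most [N - r] columns remain after it. A run that is
    not closed in time contributes 0 on the left. *)
Lemma survival_word_exp M r a k pre N N' A h : ge1 pre -> (N' <= N)%N ->
  (forall B, 0 <= h B) ->
  (forall N'' B, (N'' <= N - r)%N -> h B <= survival M N'' B) ->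
  word_exp r a k pre (fun p l => quenched_exp M (p ++ l) A h) <= quenched_exp M pre A (survival M N').
Proof.
move=> pre1 NN h0 hU; elim: k pre pre1 N' NN => [|k IH] pre pre1 N' NN.
  all: apply: (@le_trans _ _ (quenched_exp M pre A (fun B => iid_exp r (fun l => quenched_exp M l B (survival M (N' - r)))))).
  all: try (apply: quenched_le => // B; exact: survival_cell).
  all: rewrite quenched_iid_exp; apply: iid_exp_le => l lr l1; rewrite -quenched_cat.
  all: have pl1 : ge1 (pre ++ l) by rewrite ge1_cat pre1.
  all: case: ifP => la; try (by apply: quenched_le => // B; apply: hU; exact: leq_sub2r).
  by rewrite quenched_spacetime; apply: (pe_ge0 (spacetime_prodexp M pl1)) => c; exact: survival_ge0.
by apply: IH => //; apply: leq_trans NN; exact: leq_subr.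
Qed.

End Law.

(** Only the slow cells [p] enter the coarse column; the closing cell is replaced by its worst case
    [a]. Runs of more than [k + 1] cells are lost, so mass may decrease. *)
Definition coarse_law mu r a k (Z : seq R -> R) f : R :=
  word_exp mu r a k [::] (fun p _ => f (Z p)).

Lemma coarse_law_law mu r a k Z : law mu -> (forall p, ge1 p -> 1 <= Z p) ->
  law (coarse_law mu r a k Z).
Proof.
move=> hmu Z1; split.
- by move=> f g; rewrite /coarse_law word_expD.
- by move=> b f; rewrite /coarse_law word_expZ.
- by move=> f g fg; apply: word_exp_le => // p l p1 _ _ _; apply: fg; apply: Z1.
- exact: word_exp_le1.
Qed.

(** * Comparison of survival with the coarse model *)

Section Renormalization.
Variables (mu : (R -> R) -> R) (n s k : nat) (a : R) (Z : seq R -> R).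
Hypotheses (hmu : law mu) (n0 : (0 < n)%N) (tau0 : 0 <= tau n s a)
  (Z1 : forall p, ge1 p -> 1 <= Z p)
  (Zle : forall p, ge1 p ->
     (Z p)^-1 <= tau n s a * (1 - (1 - (lprod p * a)^-1) ^+ n)).
Local Notation mu' := (coarse_law mu (6 * (n * s)) a k Z).

(** Induction on [m] with [block_step] inside each run. A coarse step covers at least one cell,
    hence the bound on [N]; the term [n * s * m] leaves room for the upward drift of [d]. *)
Lemma renormalize M M' m N A d :
  (N <= 6 * (n * s) * m)%N ->
  `|d| + (n * s * m + 4 * (n * s) * (M' + 2))%:Z <= M%:Z ->
  survival mu' M' m (coarse n s d A) <= survival mu M N A.
Proof.
have hmu' := coarse_law_law (6 * (n * s)) a k hmu Z1.
elim: m N A d => [|m IH] N A d Nm dM.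
  move: Nm; rewrite muln0 leqn0 => /eqP -> /=; rewrite /alive ler_nat.
  case: asboolP => // -[J /allP fJ]; case: asboolP => // -[].
  have /fJ : iota (0 * s) s \in slots n s.
    by apply/mapP; exists 0%N => //; rewrite mem_iota; lia.
  by move=> /hasP[i _ Ai]; eexists; exact: Ai.
have dM' : `|d + (n * s)%:Z| + (n * s * m + 4 * (n * s) * (M' + 2))%:Z <= M%:Z.
  by move: dM; rewrite mulnS; lia.
set h := fun B => survival mu' M' m (coarse n s (d + (n * s)%:Z) B).
rewrite -[leRHS]/(quenched_exp M [::] A (survival mu M N)).
apply: (@le_trans _ _ (word_exp mu (6 * (n * s)) a k [::] (fun p l => quenched_exp M (p ++ l) A h))).
  apply: word_exp_le => // p l p1 l1 lr la.
  apply: (@block_step R n s M M' p l A d (survival mu' M' m) a) => //.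
  - by move: dM; rewrite PoszD; lia.
  - exact: survival_increasing.
  - by have /andP[] := inv01 (Z1 p1).
  - exact: Zle.
apply: (@survival_word_exp _ hmu _ _ _ _ _ N) => // [B|N'' B N''N].
  exact: survival_ge0.
by apply: IH => //; move: Nm N''N; rewrite mulnS; lia.
Qed.

(** An [up] comb with a single main and no slow cells: if the first cell is fine, one site fills a
    whole block, which is one site of the coarse model. *)
Lemma climb M M' m N (x : int) :
  (N - 6 * (n * s) <= 6 * (n * s) * m)%N ->
  1 <= a -> (0 < s)%N ->
  `|x| + (n * s * m + 4 * (n * s) * (M' + 4))%:Z <= M%:Z ->
  tau n s a * iid_exp mu (6 * (n * s)) (fun l => if lprod l <= a then (lprod l)^-1 else 0)
    * survival mu' M' m (pred1 0) <= survival mu M N (pred1 x).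
Proof.
move=> Nm a1 s0 xM; apply: le_trans (survival_cell hmu _ (6 * (n * s)) _ _).
have hmu' := coarse_law_law (6 * (n * s)) a k hmu Z1.
rewrite mulrAC -iid_expZ //; apply: (iid_exp_le hmu) => l lr l1.
have HE := spacetime_prodexp M l1.
case: ifP => la; last first.
  rewrite mulr0 quenched_spacetime; apply: (pe_ge0 HE) => c; exact: survival_ge0.
pose up1 := up n s 0 x (fun _ => x) [:: 0%N].
apply: (@le_trans _ _ (spacetime_exp M l (fun c => survival mu' M' m (pred1 0) * (up1 c)%:R))).
  rewrite (peZ HE) mulrAC mulrC; apply: ler_wpM2l; first exact: survival_ge0.
  have l0 := lprod_ge1 l1.
  (* [up_prob] is applied with the actual product of the cell instead of [a], so that the main costs
     only [(lprod l)^-1], which is close to 1 on average. *)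
  have tl : tau n s a <= tau n s (lprod l).
    rewrite /tau lerD2l lerN2; apply: ler_wpM2l => //; apply: lerXn2r.
    - by rewrite nnegrE subr_ge0; have /andP[] := inv01 l0.
    - by rewrite nnegrE subr_ge0; have /andP[] := inv01 a1.
    - by rewrite lerD2l lerN2 lef_pV2 ?posrE ?(lt_le_trans ltr01).
  have := @up_prob R n s M 0 x (fun _ => x) [:: 0%N] _ [::] l (lprod l) erefl lr isT l1 (lexx _).
  rewrite [in lprod [::]]/lprod big_nil mul1r /= expr1 subKr => h.
  apply: le_trans (h _ _ _ _ _) => //.
  - by apply: ler_wpM2r => //; have /andP[] := inv01 l0.
  - by move=> j _; rewrite lexx ltrDl ltz_nat muln_gt0 n0.
  - exact: le_trans tau0 tl.
  - by move: xM; lia.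
  - by move: xM; rewrite mulnDr; lia.
rewrite quenched_spacetime; apply: (pe_le HE) => c; case up1c: (up1 c); last by rewrite mulr0; exact: survival_ge0.
rewrite mulr1; apply: le_trans (renormalize (M' := M') (d := x + (4 * (n * s))%:Z) _ Nm _).
  apply: survival_increasing => // J /eqP ->; rewrite /coarse mulr0 addr0 lr.
  rewrite -[X in occupied _ _ X]add0n; apply: up_filled up1c => j _; first by rewrite /= eqxx.
  by rewrite lexx ltrDl ltz_nat muln_gt0 n0.
by move: xM; rewrite !mulnDr; lia.
Qed.

End Renormalization.

End Annealed.

(** * Estimates at level t *)

Section Estimates.
Context {R : realType}.
Implicit Types (x y u h : R) (n r t : nat).

Lemma bernoulli x n : 0 <= x -> 1 + n%:R * x <= (1 + x) ^+ n.
Proof.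
move=> x0; elim: n => [|n IH]; first by rewrite mul0r addr0 expr0.
rewrite exprS -natr1.
have := ler_wpM2l (_ : 0 <= 1 + x) IH; rewrite addr_ge0 // => /(_ isT); apply: le_trans.
have : 0 <= n%:R * x * x by rewrite !mulr_ge0.
lra.
Qed.

Lemma bernoulli_sub x n : 0 <= x <= 1 -> 1 - n%:R * x <= (1 - x) ^+ n.
Proof.
move=> /andP[x0 x1]; elim: n => [|n IH]; first by rewrite mul0r subr0 expr0.
rewrite exprS -natr1.
have := ler_wpM2l (_ : 0 <= 1 - x) IH; rewrite subr_ge0 => /(_ x1); apply: le_trans.
have : 0 <= n%:R * x * x by rewrite !mulr_ge0.
lra.
Qed.

Lemma bernoulli_up x n : 0 <= x -> 2 * n%:R * x <= 1 -> (1 + x) ^+ n <= 1 + 2 * n%:R * x.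
Proof.
move=> x0; elim: n => [|n IH]; first by rewrite mulr0 mul0r addr0 expr0.
rewrite exprS -natr1 => h.
have h' : 2 * n%:R * x <= 1 by lra.
have := ler_wpM2l (_ : 0 <= 1 + x) (IH h'); rewrite addr_ge0 // => /(_ isT) k.
apply: (le_trans k); have := ler_wpM2l x0 h'; lra.
Qed.

(** Convexity of the power on the segment from [y] to 1. It replaces [n] attempts weakened by a
    factor [u] by a single chance [u] of having the full attempts. *)
Lemma convex_exp u y n : 0 <= u <= 1 -> 0 <= y <= 1 ->
  (1 - u + u * y) ^+ n <= 1 - u + u * y ^+ n.
Proof.
move=> /andP[u0 u1] /andP[y0 y1]; elim: n => [|n IH]; first by rewrite !expr0; lra.
rewrite !exprS.
have z0 : 0 <= 1 - u + u * y by have := mulr_ge0 u0 y0; lra.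
apply: (le_trans (ler_wpM2l z0 IH)).
have y0' : 0 <= y ^+ n by rewrite exprn_ge0.
have y1' : y ^+ n <= 1 by rewrite exprn_ile1.
set w := y ^+ n in y0' y1' *.
have h1 : 0 <= u * (1 - u) * ((1 - y) * (1 - w)).
  by rewrite !mulr_ge0 // subr_ge0.
rewrite -subr_ge0; apply: (le_trans h1).
by rewrite le_eqVlt; apply/orP; left; apply/eqP; ring.
Qed.

(** With [y = 1 / n], [(1 + y) ^+ n] is at least 2 by Bernoulli, and its product with [(1 - y) ^+ n]
    is at most 1. *)
Lemma half_pow n : (0 < n)%N -> (1 - n%:R^-1) ^+ n <= 2^-1 :> R.
Proof.
move=> n0; have nR : 0 < n%:R :> R by rewrite ltr0n.
set y : R := n%:R^-1; have y0 : 0 <= y by rewrite invr_ge0 ltW.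
have y1 : y <= 1 by rewrite invf_le1 // ler1n.
have h1 : 2 <= (1 + y) ^+ n.
  have := bernoulli n y0; rewrite /y divff ?gt_eqF //; lra.
have h2 : (1 - y) ^+ n * (1 + y) ^+ n <= 1.
  rewrite -exprMn; apply: exprn_ile1; last by nra.
  by rewrite mulr_ge0 //; lra.
have h3 : 0 <= (1 - y) ^+ n by rewrite exprn_ge0 //; lra.
have := ler_wpM2l h3 h1; lra.
Qed.

Lemma pow2_ge t : (200 <= t)%N -> t%:R ^+ 20 <= 2 ^+ t :> R.
Proof.
move=> ht; rewrite -(subnK ht); elim: (t - 200)%N => [|m IH].
  (* Base case: [200 <= 2 ^ 8] and [8 * 20 <= 200]. *)
  rewrite add0n; apply: (@le_trans _ _ ((2 ^+ 8) ^+ 20)).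
    by apply: lerXn2r; rewrite ?nnegrE //; lra.
  by rewrite -exprM; apply: ler_weXn2l => //; lra.
rewrite addSn [in leRHS]exprS -natr1; set u := (m + 200)%N in IH *.
have u200 : 200 <= u%:R :> R by rewrite /u natrD; have : 0 <= m%:R :> R by []; lra.
have u0 : 0 < u%:R :> R by lra.
have -> : u%:R + 1 = u%:R * (1 + u%:R^-1) :> R by rewrite mulrDr mulr1 divff ?gt_eqF.
have i40 : 2 * 20%:R * u%:R^-1 <= 1 :> R by rewrite -/(_ / _) ler_pdivrMr //; lra.
have := @bernoulli_up u%:R^-1 20 (ltW _) i40; rewrite invr_gt0 => /(_ u0) h.
have a0 : 0 <= u%:R ^+ 20 :> R by apply: exprn_ge0; lra.
have b0 : 0 <= (1 + u%:R^-1) ^+ 20 :> R by apply: exprn_ge0; rewrite addr_ge0 // invr_ge0 ltW.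
have c2 : (1 + u%:R^-1) ^+ 20 <= 2 :> R by lra.
rewrite exprMn [leRHS]mulrC; exact: ler_pM.
Qed.

Lemma inv8_le x : 0 <= x -> 8 * x <= 2^-1 -> (1 - x) ^- 8 <= 1 + 16 * x.
Proof.
move=> x0 x1; have h1 : 1 - 8%:R * x <= (1 - x) ^+ 8 by apply: bernoulli_sub; lra.
have p : 0 < 1 - 8%:R * x by lra.
apply: (@le_trans _ _ (1 - 8%:R * x)^-1).
  by rewrite lef_pV2 ?posrE // (lt_le_trans p).
rewrite -[leLHS]mul1r ler_pdivrMr //; nra.
Qed.

End Estimates.

Section Level.
Context {R : realType}.
Variable t : nat.
Hypothesis t200 : (200 <= t)%N.
Implicit Types (u : R) (p l : seq R).

Let x : R := t%:R^-1.
Let h : R := 2 ^- t.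

Let tR : 200 <= t%:R :> R.
Proof. by rewrite (ler_nat R 200). Qed.

Let t0 : 0 < t%:R :> R.
Proof. by have := tR; lra. Qed.

Let x0 : 0 < x.
Proof. by rewrite invr_gt0 t0. Qed.

Let xsmall : 200 * x <= 1.
Proof. by rewrite /x ler_pdivrMr // mul1r tR. Qed.

Let tx : t%:R * x = 1.
Proof. by rewrite divff // gt_eqF. Qed.

Let h0 : 0 < h.
Proof. by rewrite invr_gt0 exprn_gt0. Qed.

Let hx : h <= x ^+ 20.
Proof.
rewrite /x exprVn /h lef_pV2 ?posrE ?exprn_gt0 //; exact: pow2_ge.
Qed.

Let x_le (i j : nat) : (i <= j)%N -> x ^+ j <= x ^+ i.
Proof.
move=> ij; apply: ler_wiXn2l => //; first exact: ltW.
by have := xsmall; have := x0; lra.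
Qed.

(** With width [t ^ 2], teeth of probability [1 / t] all miss a slot with probability at most
    [2 ^- t]. With [t ^ 3] mains, attempts of probability [1 / t ^ 2] all fail with probability at
    most [2 ^- t]. *)
Definition slot_count := (t ^ 3)%N.
Definition slot_width := (t ^ 2)%N.
Local Notation n := slot_count.
Local Notation s := slot_width.

(* [h] bounds the probability that a slot is missed and that all [n] attempts fail. *)
Definition kappa : R := (1 - (2 * n)%:R * h) * (1 - h).
(** The [n] attempts gain the factor [t] against the product of the slow cells; [kappa] pays for the
    two exponentially small errors. *)
Definition cost p : R := Num.max 1 (lprod p / t%:R) / kappa.

Let nh : (2 * n)%:R * h <= 2 * x ^+ 17.
Proof.
apply: (@le_trans _ _ ((2 * n)%:R * x ^+ 20)); first by apply: ler_wpM2l.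
rewrite /n natrM natrX -[20%N]/(3 + 17)%N exprD mulrA -[_ * x ^+ 3]mulrA -exprMn tx.
by rewrite expr1n mulr1.
Qed.

Let half_t : (1 - x) ^+ s <= h.
Proof.
rewrite /s -[X in (t ^ X)%N]/(1 + 1)%N expnD expn1 exprM /h -exprVn.
apply: lerXn2r.
- by rewrite nnegrE exprn_ge0 // subr_ge0; have := xsmall; have := x0; lra.
- by rewrite nnegrE invr_ge0.
- by apply: half_pow; lia.
Qed.

Let half_t2 : (1 - x ^+ 2) ^+ n <= h.
Proof.
rewrite /n (expnSr t 2) exprM /h -exprVn.
apply: lerXn2r.
- rewrite nnegrE exprn_ge0 // subr_ge0 exprn_ile1 //; first exact: ltW.
  by have := xsmall; have := x0; lra.
- by rewrite nnegrE invr_ge0.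
- by have := @half_pow R (t ^ 2); rewrite natrX exprVn; apply; lia.
Qed.

Lemma tau_lb : 1 - (2 * n)%:R * h <= tau n s t%:R.
Proof. by rewrite /tau lerD2l lerN2; apply: ler_wpM2l. Qed.

Let x17 : x ^+ 17 <= x / 200.
Proof.
rewrite exprS; apply: ler_wpM2l; first exact: ltW.
by apply: (le_trans (x_le (i := 1) _)) => //; rewrite expr1; have := xsmall; lra.
Qed.

Let x17_0 : 0 < x ^+ 17. Proof. exact: exprn_gt0. Qed.

Let nh1 : (2 * n)%:R * h <= 1.
Proof. by have := nh; have := x17; have := xsmall; have := x0; lra. Qed.

Lemma tau_ge0 : 0 <= tau n s (t%:R : R).
Proof. by apply: le_trans tau_lb; rewrite subr_ge0 nh1. Qed.

Lemma tau_ge : 1 - 2 * x ^+ 17 <= tau n s t%:R.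
Proof. by apply: le_trans tau_lb; rewrite lerD2l lerN2 nh. Qed.

Let h17 : h <= x ^+ 17.
Proof. by apply: (le_trans hx); apply: x_le. Qed.

Lemma kappa_ge : 1 - 3 * x ^+ 17 <= kappa.
Proof.
rewrite /kappa; have := nh; have := h17; have := h0.
have := mulr_ge0 (ler0n R (2 * n)) (ltW h0).
set b := _%:R * h; set c := x ^+ 17; move=> b0 h1 h2 h3.
have := mulr_ge0 b0 (ltW h1); lra.
Qed.

Let x17_small : 3 * x ^+ 17 <= 1 / 1000.
Proof. by have := x17; have := xsmall; lra. Qed.

Lemma kappa_gt0 : 0 < kappa.
Proof. by apply: lt_le_trans kappa_ge; have := x17_small; lra. Qed.

Lemma kappa_le1 : kappa <= 1.
Proof.
rewrite /kappa; apply: mulr_ile1; rewrite ?subr_ge0 ?nh1 //.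
- by have := h17; have := x17_small; lra.
- by rewrite lerBlDr lerDl mulr_ge0 // ltW.
- by have := h0; lra.
Qed.

Lemma cost_ge1 p : 1 <= cost p.
Proof.
rewrite /cost ler_pdivlMr ?kappa_gt0 // mul1r; apply: (le_trans kappa_le1).
by rewrite le_max lexx.
Qed.

(** If [lprod p <= t], an attempt has probability at least [x ^+ 2] and [half_t2] applies. Otherwise
    it has probability [u * x ^+ 2] with [u = t / lprod p], and [convex_exp] gives success with
    probability at least [u * (1 - h)]. *)
Lemma cost_le p : ge1 p ->
  (cost p)^-1 <= tau n s t%:R * (1 - (1 - (lprod p * t%:R)^-1) ^+ n).
Proof.
move=> p1; have P1 := lprod_ge1 p1; have P0 : 0 < lprod p by lra.
rewrite /cost invf_div /kappa -mulrA; apply: ler_pM.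
- by rewrite subr_ge0 nh1.
- rewrite mulr_ge0 ?invr_ge0 ?le_max ?ler01 // subr_ge0.
  by have := h17; have := x17_small; lra.
- exact: tau_lb.
rewrite invfM -/x.
have [Pt|Pt] := leP (lprod p / t%:R) 1.
  rewrite invr1 mulr1 lerD2l lerN2; apply: le_trans half_t2.
  have hP : x <= (lprod p)^-1.
    by rewrite /x lef_pV2 ?posrE // -[t%:R]mul1r -ler_pdivrMr.
  have hP1 : (lprod p)^-1 <= 1 by rewrite invf_le1.
  apply: lerXn2r.
  + rewrite nnegrE subr_ge0; apply: mulr_ile1 => //; [|exact: ltW|].
      by rewrite invr_ge0 ltW.
    by have := xsmall; have := x0; lra.
  + rewrite nnegrE subr_ge0 exprn_ile1 //; first exact: ltW.
    by have := xsmall; have := x0; lra.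
  + by rewrite lerD2l lerN2 expr2; apply: ler_wpM2r => //; exact: ltW.
rewrite invf_div; set u := t%:R / lprod p.
have u0 : 0 <= u by rewrite divr_ge0 // ltW.
have u1 : u <= 1.
  by rewrite /u ler_pdivrMr // mul1r -[t%:R]mul1r -ler_pdivlMr // ltW.
have -> : (lprod p)^-1 * x = u * x ^+ 2.
  by rewrite /u expr2 mulrACA tx mul1r.
have x2 : 0 <= 1 - x ^+ 2 <= 1.
  rewrite subr_ge0 lerBlDr lerDl exprn_ge0 ?(ltW x0) // exprn_ile1 //; first exact: ltW.
  by have := xsmall; have := x0; lra.
have := @convex_exp R u (1 - x ^+ 2) n; rewrite u0 u1 => /(_ isT x2).
have -> : 1 - u + u * (1 - x ^+ 2) = 1 - u * x ^+ 2 by ring.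
have := ler_wpM2l u0 half_t2.
by lra.
Qed.

End Level.

(** * Moments and masses along the levels *)

Section GoodLaws.
Context {R : realType}.
Implicit Types (mu : (R -> R) -> R) (D : R) (t r : nat) (p l pre : seq R).

(** The invariant passed from level [t] to [t + 1]. A small moment of a sub-probability could come
    from missing mass, so the defect [D] is tracked as well. *)
Record good t D mu : Prop := Good {
  good_law : law mu;
  good_mass : 1 - D <= mu (fun _ => 1);
  good_moment : mu (fun z => z ^+ 8) <= 1 + t%:R ^- 8 }.

Lemma lprod_cons z l : lprod (z :: l) = z * lprod l :> R.
Proof. exact: big_cons. Qed.

Lemma iid_exp_prod mu r e : law mu ->
  iid_exp mu r (fun l => lprod l ^+ e) = mu (fun z => z ^+ e) ^+ r.
Proof.
move=> hmu; elim: r => [|r IH] /=; first by rewrite /lprod big_nil expr1n expr0.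
rewrite exprS -IH mulrC -(lawZ hmu); congr mu; apply/funext => z.
by rewrite mulrC -(iid_expZ hmu); congr iid_exp; apply/funext => l; rewrite lprod_cons exprMn.
Qed.

Lemma iid_exp_mass mu r : law mu -> iid_exp mu r (fun _ => 1) = mu (fun _ => 1) ^+ r.
Proof.
by move=> hmu; rewrite -(iid_exp_prod r 0 hmu).
Qed.

Section Step.
Variables (t : nat) (D : R) (mu : (R -> R) -> R).
Hypotheses (t200 : (200 <= t)%N) (hg : good t D mu) (D0 : 0 < D) (Dle : D <= t%:R ^- 8).
Local Notation n := (slot_count t).
Local Notation s := (slot_width t).
Local Notation r := (6 * (n * s))%N.

Let hmu := good_law hg.
Let x : R := t%:R^-1.

Let tR : 200 <= t%:R :> R.
Proof. by rewrite (ler_nat R 200). Qed.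

Let t0 : 0 < t%:R :> R.
Proof. by have := tR; lra. Qed.

Let x0 : 0 < x.
Proof. by rewrite invr_gt0 t0. Qed.

Let xsmall : 200 * x <= 1.
Proof. by rewrite /x ler_pdivrMr // mul1r tR. Qed.

Let tx : t%:R * x = 1.
Proof. by rewrite divff // gt_eqF. Qed.

Let rx (i : nat) : r%:R * x ^+ (5 + i) = 6 * x ^+ i.
Proof.
have -> : r = (6 * t ^ 5)%N by rewrite /slot_count /slot_width -expnD.
rewrite natrM natrX exprD mulrA -[_ * x ^+ 5]mulrA.
by rewrite -exprMn tx expr1n mulr1.
Qed.

Let moment : mu (fun z => z ^+ 8) <= 1 + x ^+ 8.
Proof. by rewrite /x exprVn; exact: good_moment hg. Qed.

Let Dx : D <= x ^+ 8.
Proof. by rewrite /x exprVn. Qed.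

Let x3 : 200 * x ^+ 3 <= x ^+ 2.
Proof. by rewrite exprS mulrA ler_piMl // exprn_ge0 // ltW. Qed.

Let x2 : 200 * x ^+ 2 <= x.
Proof. by rewrite exprS expr1 mulrA ler_piMl // ltW. Qed.

Let x3_0 : 0 < x ^+ 3.
Proof. exact: exprn_gt0. Qed.

Let rD : r%:R * D <= 6 * x ^+ 3.
Proof. by rewrite -(rx 3); apply: ler_wpM2l. Qed.

Lemma cell_moment : iid_exp mu r (fun l => lprod l ^+ 8) <= 1 + 12 * x ^+ 3.
Proof.
rewrite iid_exp_prod //; apply: (@le_trans _ _ ((1 + x ^+ 8) ^+ r)).
  apply: lerXn2r => //; rewrite ?nnegrE.
    by apply: (law_ge0 hmu) => z z1; rewrite exprn_ge0 // (le_trans ler01).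
  by rewrite addr_ge0 // exprn_ge0 // ltW.
have x8 : 0 <= x ^+ 8 by rewrite exprn_ge0 // ltW.
have e : 2 * r%:R * x ^+ 8 = 12 * x ^+ 3 by rewrite -mulrA (rx 3); lra.
by have := @bernoulli_up R _ r x8; rewrite e; apply; have := x3; have := x2; have := xsmall; lra.
Qed.

Lemma cell_mass : 1 - r%:R * D <= iid_exp mu r (fun _ => 1).
Proof.
rewrite iid_exp_mass //.
have D1 : D <= 1.
  apply: (le_trans Dx); apply: exprn_ile1; first exact: ltW.
  by have := xsmall; have := x0; lra.
apply: (le_trans (@bernoulli_sub R D r _)); first by rewrite D1 ltW.
by apply: lerXn2r; rewrite ?nnegrE ?subr_ge0 ?D1 ?(le_trans _ (good_mass hg)) ?subr_ge0 //; exact: good_mass hg.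
Qed.

Definition bad_moment : R :=
  iid_exp mu r (fun l => if lprod l <= t%:R then 0 else lprod l ^+ 8).

Lemma bad_moment_ge0 : 0 <= bad_moment.
Proof.
apply: (iid_exp_ge0 hmu) => l l1; case: ifP => // _.
by rewrite exprn_ge0 // (le_trans ler01) // lprod_ge1.
Qed.

(** On a cell with product above [t], [(x * lprod l) ^+ 8] is at least 1, and elsewhere the eighth
    power is at least 1. So [(1 - x ^+ 8) * bad_moment] is at most the moment minus the mass of a
    cell, that is [18 * x ^+ 3]. *)
Lemma bad_moment_le : bad_moment <= 36 * x ^+ 3.
Proof.
have h : (1 - x ^+ 8) * bad_moment + iid_exp mu r (fun _ => 1) <= iid_exp mu r (fun l => lprod l ^+ 8).
  rewrite /bad_moment -(iid_expZ hmu) -(iid_expD hmu).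
  apply: (iid_exp_le hmu) => l _ l1; have P1 := lprod_ge1 l1.
  case: ifP => [_|/negbT]; first by rewrite mulr0 add0r exprn_ege1.
  rewrite -ltNge => tP; rewrite mulrBl mul1r -addrA gerDl addrC subr_le0 -exprMn.
  by apply: exprn_ege1; rewrite mulrC -ler_pdivrMr ?x0 // /x invrK mul1r ltW.
have := cell_moment; have := cell_mass.
have h8 : x ^+ 8 <= 1 / 2.
  apply: (@le_trans _ _ x); last by have := xsmall; lra.
  rewrite -[leRHS]expr1; apply: ler_wiXn2l => //; first exact: ltW.
  by have := xsmall; have := x0; lra.
have := bad_moment_ge0; have := rD.
set b := bad_moment in h *; set y := x ^+ 8 in h h8 *.
move=> h1 b0 h2 h3.
have : y * b <= 1 / 2 * b by apply: ler_wpM2r.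
by lra.
Qed.

Let bad_half : bad_moment <= 1 / 2.
Proof. by apply: (le_trans bad_moment_le); have := x3; have := x2; have := xsmall; lra. Qed.

Lemma bad_mass_le : iid_exp mu r (fun l => if lprod l <= t%:R then 0 else 1) <= bad_moment.
Proof.
apply: (iid_exp_le hmu) => l _ l1; case: ifP => // _; apply: exprn_ege1; exact: lprod_ge1.
Qed.

(** A cell fails to be fine with probability at most 1/2. Hence runs that do not close lose at most
    [2 ^- k.+1], and the defects [r * D] of successive cells add up to at most twice the first. *)
Lemma word_exp_mass k pre : ge1 pre ->
  1 - 2 * (r%:R * D) - 2 ^- k.+1 <= word_exp mu r t%:R k pre (fun _ _ => 1).
Proof.
set b := iid_exp mu r (fun l => if lprod l <= t%:R then 0 else 1 : R).
have b0 : 0 <= b by apply: (iid_exp_ge0 hmu) => l _; case: ifP.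
have b1 : b <= 1 / 2 by apply: le_trans bad_mass_le bad_half.
have rD0 : 0 <= r%:R * D by rewrite mulr_ge0 // ltW.
have mass := cell_mass.
elim: k pre => [|k IH] pre pre1.
  have : iid_exp mu r (fun _ => 1) = b + word_exp mu r t%:R 0 pre (fun _ _ => 1).
    rewrite -(iid_expD hmu) /=; congr (iid_exp _ _ _).
    by apply/funext => l; case: ifP; rewrite ?addr0 ?add0r.
  by rewrite expr1; lra.
set v := 1 - 2 * (r%:R * D) - 2 ^- k.+1 in IH *.
apply: (@le_trans _ _ (iid_exp mu r (fun _ => 1) - b + v * b)).
  rewrite /v (exprS 2 k.+1) invfM.
  have i0 : 0 < 2 ^- k.+1 :> R by rewrite invr_gt0 exprn_gt0.
  have : b * (2 * (r%:R * D) + 2 ^- k.+1) <= 1 / 2 * (2 * (r%:R * D) + 2 ^- k.+1).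
    by apply: ler_wpM2r => //; lra.
  by lra.
rewrite addrAC lerBlDr -(iid_expZ hmu) -!(iid_expD hmu).
apply: (iid_exp_le hmu) => l _ l1; case: ifP => _; first by rewrite mulr0.
by rewrite mulr1 addrC lerD2r; apply: IH; rewrite ge1_cat pre1.
Qed.

Let Phi := fun p (_ : seq R) => (Num.max 1 (lprod p / t%:R)) ^+ 8 : R.

(** Once the product has passed [t], the maximum in [Phi] is [lprod pre / t]. Each further slow cell
    brings a factor [bad_moment] of at most 1/2, and the geometric series sums to 2. *)
Lemma word_exp_moment_bad k pre : ge1 pre -> t%:R <= lprod pre ->
  word_exp mu r t%:R k pre Phi <= 2 * (lprod pre / t%:R) ^+ 8.
Proof.
elim: k pre => [|k IH] pre pre1 tp.
  set P := (_ / _) ^+ 8.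
  have eP : Phi pre = fun _ => P.
    apply/funext => l; rewrite /Phi; congr (_ ^+ _); apply/max_idPr.
    by rewrite ler_pdivlMr // mul1r.
  have P0 : 0 <= P by rewrite exprn_ge0 // divr_ge0 // ltW // (lt_le_trans ltr01) // lprod_ge1.
  apply: (@le_trans _ _ (iid_exp mu r (fun _ => P * 1))).
    by apply: (iid_exp_le hmu) => l _ _; case: ifP; rewrite ?eP mulr1.
  rewrite (iid_expZ hmu); apply: (@le_trans _ _ (P * 1)); last by lra.
  by apply: ler_wpM2l => //; apply: (iid_exp_le1 hmu).
set P := (lprod pre / _) ^+ 8.
have eP : Phi pre = fun _ => P.
  apply/funext => l; rewrite /Phi; congr (_ ^+ _); apply/max_idPr.
  by rewrite ler_pdivlMr // mul1r.
have P0 : 0 <= P by rewrite exprn_ge0 // divr_ge0 // ltW // (lt_le_trans ltr01) // lprod_ge1.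
apply: (@le_trans _ _ (iid_exp mu r (fun l => P * 1 + (2 * P) * (if lprod l <= t%:R then 0 else lprod l ^+ 8)))).
  apply: (iid_exp_le hmu) => l _ l1 /=; case: ifP => la.
    by rewrite eP mulr0 addr0 mulr1.
  have P1 := lprod_ge1 l1.
  apply: (le_trans (IH _ _ _)); first by rewrite ge1_cat pre1.
    rewrite lprod_cat (le_trans tp) // ler_peMr // (le_trans ler01) //; exact: lprod_ge1.
  rewrite lprod_cat mulrAC exprMn -/P.
  by have := P0; lra.
rewrite (iid_expD hmu) !(iid_expZ hmu) -/bad_moment.
have : P * iid_exp mu r (fun _ => 1) <= P * 1 by apply: ler_wpM2l => //; apply: (iid_exp_le1 hmu).
have : 2 * P * bad_moment <= 2 * P * (1 / 2) by apply: ler_wpM2l bad_half; rewrite mulr_ge0.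
by lra.
Qed.

(** If the first cell is fine, [Phi] is 1. Otherwise the division by [t] supplies [x ^+ 8], on top
    of the [x ^+ 3] from [bad_moment_le]. *)
Lemma word_exp_moment k : word_exp mu r t%:R k [::] Phi <= 1 + 72 * x ^+ 11.
Proof.
have e1 l : Phi [::] l = 1.
  rewrite /Phi /lprod big_nil mul1r -/x (max_idPl _) ?expr1n //.
  by have := xsmall; have := x0; lra.
apply: (@le_trans _ _ (iid_exp mu r (fun l => 1 + (2 * x ^+ 8) * (if lprod l <= t%:R then 0 else lprod l ^+ 8)))).
  have x8 : 0 <= 2 * x ^+ 8 by rewrite mulr_ge0 // exprn_ge0 // ltW.
  case: k => [|k]; apply: (iid_exp_le hmu) => l _ l1; case: ifP => [la|/negbT la].
  - by rewrite e1 mulr0 addr0.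
  - by rewrite addr_ge0 // mulr_ge0 // exprn_ge0 // (le_trans ler01) // lprod_ge1.
  - by rewrite e1 mulr0 addr0.
  rewrite -ltNge in la; apply: (le_trans (word_exp_moment_bad _ _ _)) => //; first exact: ltW.
  by rewrite exprMn -/x; set L := lprod l ^+ 8; set y := x ^+ 8; lra.
rewrite (iid_expD hmu) !(iid_expZ hmu) -/bad_moment.
have h1 : iid_exp mu r (fun _ => 1) <= 1 by apply: (iid_exp_le1 hmu).
have x8 : 0 <= x ^+ 8 by rewrite exprn_ge0 // ltW.
have h2 : 2 * x ^+ 8 * bad_moment <= 2 * x ^+ 8 * (36 * x ^+ 3).
  by apply: ler_wpM2l bad_moment_le; rewrite mulr_ge0.
rewrite (exprD x 8 3); lra.
Qed.

(** The new excess is of order [x ^+ 11], plus [x ^+ 17] from [kappa], whereas [t.+1 ^- 8] is still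
    at least [x ^+ 8 / 2]. *)
Lemma good_coarse k D' : 2 * (r%:R * D) + 2 ^- k.+1 <= D' ->
  good t.+1 D' (coarse_law mu r t%:R k (cost t)).
Proof.
move=> hD'; split.
- by apply: coarse_law_law => // p _; exact: cost_ge1.
- by apply: le_trans (word_exp_mass k (isT : ge1 [::])); lra.
have k0 := @kappa_gt0 R t t200.
have -> : coarse_law mu r t%:R k (cost t) (fun z => z ^+ 8) =
    kappa t ^- 8 * word_exp mu r t%:R k [::] Phi.
  rewrite -(word_expZ hmu) /coarse_law; congr word_exp; apply/funext => p; apply/funext => l.
  by rewrite /cost exprMn exprVn mulrC.
have x17 : x ^+ 17 <= x ^+ 11 / 200.
  rewrite (exprD x 11 6); apply: ler_wpM2l; first by rewrite exprn_ge0 // ltW.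
  rewrite (exprD x 1 5) expr1.
  have : x ^+ 5 <= 1 by apply: exprn_ile1; [exact: ltW|have := xsmall; have := x0; lra].
  move=> /(ler_wpM2l (ltW x0)); have := xsmall; lra.
have x11 : x ^+ 11 <= x ^+ 8 / 200 * (1 / 200).
  rewrite (exprD x 8 3) -mulrA; apply: ler_wpM2l; first by rewrite exprn_ge0 // ltW.
  by have := x3; have := x2; have := xsmall; lra.
have x8_1 : x ^+ 8 <= 1 by apply: exprn_ile1; [exact: ltW|have := xsmall; have := x0; lra].
have x11_0 : 0 < x ^+ 11 by apply: exprn_gt0.
have x17_0 : 0 < x ^+ 17 by apply: exprn_gt0.
have kap : kappa t ^- 8 <= 1 + 48 * x ^+ 17.
  have := @inv8_le R (3 * x ^+ 17) _ _.
  have -> : 16 * (3 * x ^+ 17) = 48 * x ^+ 17 by lra.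
  move=> h; apply: le_trans (h _ _); try lra.
  have kg := @kappa_ge R t t200; rewrite -/x in kg.
  by rewrite lef_pV2 ?posrE ?exprn_gt0 //; [apply: lerXn2r => //; rewrite nnegrE|]; lra.
have W := word_exp_moment k.
have tgt : x ^+ 8 / 2 <= t.+1%:R ^- 8.
  have -> : t.+1%:R = t%:R * (1 + x) :> R by rewrite mulrDr mulr1 tx -natr1.
  rewrite exprMn invfM -exprVn -/x; apply: ler_wpM2l.
    by rewrite exprn_ge0 // ltW.
  rewrite lef_pV2 ?posrE ?exprn_gt0 //; last by have := x0; lra.
  have h16 : 2 * 8%:R * x <= 1 by have := xsmall; have := x0; lra.
  by apply: (le_trans (bernoulli_up (ltW x0) h16)); lra.
apply: (@le_trans _ _ ((1 + 48 * x ^+ 17) * (1 + 72 * x ^+ 11))).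
  apply: ler_pM => //; first by rewrite invr_ge0 exprn_ge0 // ltW.
  apply: (@le_trans _ _ (word_exp mu r t%:R k [::] (fun _ _ => 0))).
    rewrite -[leLHS](mul0r (word_exp mu r t%:R k [::] (fun _ _ => 1))) -(word_expZ hmu).
    by apply: (word_exp_le hmu) => // p l _ _ _ _; rewrite mul0r.
  apply: (word_exp_le hmu) => // p l _ _ _ _; apply: exprn_ge0.
  by rewrite le_max ler01.
move: tgt; set a := x ^+ 17 in x17 x17_0 *; set b := x ^+ 11 in x17 x11 x11_0 *.
set y := x ^+ 8 in x11 x8_1 *; set T := _ ^- 8; move=> tgt.
have ab : a * b <= 1 * b by apply: ler_wpM2r; lra.
by lra.
Qed.

(** With [P = lprod l], fine cells satisfy [2 <= P^-1 + P <= P^-1 + P ^+ 8], and the others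
    [2 <= P ^+ 8]. Comparing mass and moment, the mean of [P^-1] over fine cells is at least
    [1 - 24 * x ^+ 3], and this loss is small against [x ^+ 2 / 2]. *)
Lemma climb_ge :
  1 - 1 / (t%:R * t.+1%:R) <= tau n s t%:R *
    iid_exp mu r (fun l => if lprod l <= t%:R then (lprod l)^-1 else 0).
Proof.
set C := iid_exp _ _ _.
have tau1 := @tau_ge R t t200; rewrite -/x in tau1.
have hC : 1 - 24 * x ^+ 3 <= C.
  have h1 : 2 * iid_exp mu r (fun _ => 1) <= C + iid_exp mu r (fun l => lprod l ^+ 8).
    rewrite -(iid_expZ hmu) -(iid_expD hmu); apply: (iid_exp_le hmu) => l _ l1.
    have P1 := lprod_ge1 l1.
    have P8 : lprod l <= lprod l ^+ 8 by rewrite exprS ler_peMr ?exprn_ege1 // (le_trans ler01).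
    case: ifP => [_|/negbT]; last by rewrite -ltNge => tP; have := tR; lra.
    apply: (@le_trans _ _ ((lprod l)^-1 + lprod l)); last by lra.
    have P0 : 0 < lprod l by lra.
    rewrite -subr_ge0; have -> : (lprod l)^-1 + lprod l - 2 * 1 = (lprod l - 1) ^+ 2 / lprod l.
      by field; rewrite gt_eqF.
    by rewrite divr_ge0 ?sqr_ge0 // ltW.
  by have := cell_moment; have := cell_mass; have := rD; lra.
have x17 : x ^+ 17 <= x ^+ 3.
  by apply: ler_wiXn2l => //; [exact: ltW|have := xsmall; have := x0; lra].
have hx2 : 1 / (t%:R * t.+1%:R) >= x ^+ 2 / 2.
  have -> : t.+1%:R = t%:R * (1 + x) :> R by rewrite mulrDr mulr1 tx -natr1.
  rewrite mulrA -expr2 div1r invfM -exprVn -/x; apply: ler_wpM2l.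
    by rewrite exprn_ge0 // ltW.
  by rewrite lef_pV2 ?posrE //; have := xsmall; have := x0; lra.
have x33 := x3; have x3pos := x3_0.
have small : x ^+ 3 <= 1 / 1000 by have := x3; have := x2; have := xsmall; lra.
apply: (@le_trans _ _ ((1 - 2 * x ^+ 17) * (1 - 24 * x ^+ 3))).
  have : 0 <= x ^+ 17 * x ^+ 3 by rewrite mulr_ge0 // exprn_ge0 // ltW.
  move: hx2 x17 x33 x3pos; set T := _ / (_ * _); set a := x ^+ 17; set b := x ^+ 3.
  by set y := x ^+ 2; lra.
by apply: ler_pM => //; lra.
Qed.

End Step.

(* The mass lost by truncation is multiplied by at most [2 r] at each level, so it
   is prescribed backwards from the last level. *)
Lemma refine_error t r (D' : R) : (0 < r)%N -> 0 < t%:R :> R -> 0 < D' ->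
  exists D k, [/\ 0 < D, D <= t%:R ^- 8 & 2 * (r%:R * D) + 2 ^- k.+1 <= D'].
Proof.
move=> r0 t0 D'0; have rR : 0 < r%:R :> R by rewrite ltr0n.
pose D := Num.min (t%:R ^- 8) (D' / (4 * r%:R)).
have rD : 2 * (r%:R * D) <= D' / 2.
  have : D <= D' / (4 * r%:R) by rewrite ge_min lexx orbT.
  rewrite ler_pdivlMr ?mulr_gt0 //; lra.
have [k hk] : exists k, 2 ^- k.+1 <= D' / 2.
  have [m hm] : exists m : nat, 2 / D' < m%:R.
    by eexists; apply: archi_boundP; rewrite divr_ge0 // ltW.
  exists m; rewrite -[leRHS]invrK invf_div lef_pV2 ?posrE ?exprn_gt0 ?divr_gt0 //.
  apply: (le_trans (ltW hm)); rewrite -natrX ler_nat.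
  by apply: (leq_trans (ltnW (ltn_expl m (ltnSn 1)))); rewrite leq_exp2l.
exists D, k; split; first by rewrite lt_min invr_gt0 exprn_gt0 // divr_gt0 // mulr_gt0.
  by rewrite ge_min lexx.
by lra.
Qed.

(** Induction on the horizon: filling a block uses up at least one column, and the coarse model at
    level [t + 1] then has to survive at most [j] steps. The losses [1 / (t * (t + 1))] telescope to
    [1 / t]. *)
Lemma survive_single j t : (200 <= t)%N -> exists2 D : R, 0 < D &
  forall mu, good t D mu -> forall (N : nat) (x : int), (N <= j)%N ->
  exists M0, forall M, (M0 <= M)%N -> 1 - t%:R^-1 <= survival mu M N (pred1 x).
Proof.
elim: j t => [|j IH] t t200.
  exists 1 => // mu hg N x; rewrite leqn0 => /eqP ->; exists 0%N => M _ /=.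
  rewrite /alive; case: asboolP => [_|[]]; last by exists x; rewrite /= eqxx.
  by rewrite gerBl invr_ge0.
have [D' D'0 HD'] := IH t.+1 (leqW t200).
have t0 : 0 < t%:R :> R by rewrite ltr0n; lia.
pose r := (6 * (slot_count t * slot_width t))%N.
have n0 : (0 < slot_count t)%N by rewrite expn_gt0; lia.
have s0 : (0 < slot_width t)%N by rewrite expn_gt0; lia.
have r0 : (0 < r)%N by rewrite /r muln_gt0 /= muln_gt0 n0.
have rR : 0 < r%:R :> R by rewrite ltr0n.
have [D [k [D0 Dle hD]]] := refine_error r0 t0 D'0.
exists D => // mu hg N x Nj.
have hg' : good t.+1 D' (coarse_law mu r t%:R k (cost t)).
  exact: (good_coarse t200 hg D0 Dle hD).
have [M0' HM0'] := HD' _ hg' j 0 (leqnn j).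
exists (absz x + (slot_count t * slot_width t * j +
  4 * (slot_count t * slot_width t) * (M0' + 4)))%N => M hM.
have := @climb R mu _ _ k t%:R (cost t) (good_law hg) n0 (tau_ge0 t200)
  (fun p _ => cost_ge1 t200 p) (cost_le t200) M M0' j N x.
have hN : (N - r <= r * j)%N.
  by apply: (@leq_trans j); [rewrite leq_subLR; lia|rewrite leq_pmull].
have t1 : 1 <= t%:R :> R by rewrite ler1n; lia.
move=> /(_ hN t1 s0) hc.
have {}hc : tau (slot_count t) (slot_width t) t%:R *
    iid_exp mu r (fun l => if lprod l <= t%:R then (lprod l)^-1 else 0) *
    survival (coarse_law mu r t%:R k (cost t)) M0' j (pred1 0) <= survival mu M N (pred1 x).
  by apply: hc; move: hM; rewrite -/(slot_count t) -/(slot_width t); lia.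
apply: le_trans hc; have hL := climb_ge t200 hg D0 Dle.
have hU := HM0' _ (leqnn M0').
have T1 : 0 < t.+1%:R :> R by rewrite ltr0n.
have i1 : 0 <= 1 - t.+1%:R^-1 :> R by rewrite subr_ge0 invf_le1 // ler1n.
have i2 : 0 <= 1 - 1 / (t%:R * t.+1%:R) :> R.
  by rewrite subr_ge0 ler_pdivrMr ?mulr_gt0 // mul1r mulr_ege1 // ler1n.
apply: le_trans (ler_pM i2 i1 hL hU).
(* As [1 / t = 1 / (t + 1) + 1 / (t * (t + 1))], the product exceeds the target by exactly this
   cross term. *)
have p0 : 0 <= t.+1%:R^-1 / (t%:R * t.+1%:R) :> R by rewrite divr_ge0 ?invr_ge0 ?mulr_ge0.
rewrite -subr_ge0; apply: (le_trans p0); rewrite le_eqVlt; apply/orP; left; apply/eqP.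
rewrite -natr1; field.
by rewrite natr1 !gt_eqF.
Qed.

(** A fully occupied interval fills blocks outright, so passing to the next level costs no
    probability. The length [b] is chosen before the horizon [j]; only the defect [D] depends on
    [j]. *)
Lemma survive_interval k t : (200 <= t)%N -> exists b : nat, forall j,
  exists2 D : R, 0 < D &
  forall mu, good t D mu -> forall (N : nat) (x : int), (N <= j)%N ->
  exists M0, forall M, (M0 <= M)%N ->
    1 - (t + k)%:R^-1 <= survival mu M N (fun y => x <= y <= x + b%:Z).
Proof.
elim: k t => [|k IH] t t200.
  exists 0%N => j; have [D D0 HD] := survive_single j t200.
  exists D => // mu hg N x Nj; have [M0 HM] := HD mu hg N x Nj.
  exists M0 => M /HM; rewrite addn0 => /le_trans; apply.
  by apply: survival_increasing (good_law hg) _ _ _ _ _ => y /eqP ->; rewrite addr0 lexx.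
have [b' Hb] := IH t.+1 (leqW t200).
have t0 : 0 < t%:R :> R by rewrite ltr0n; lia.
set n := slot_count t; set s := slot_width t.
pose r := (6 * (n * s))%N.
have n0 : (0 < n)%N by rewrite expn_gt0; lia.
have s0 : (0 < s)%N by rewrite expn_gt0; lia.
have r0 : (0 < r)%N by rewrite /r muln_gt0 /= muln_gt0 n0.
have rR : 0 < r%:R :> R by rewrite ltr0n.
exists (4 * (n * s) * b'.+1)%N => j; have [D' D'0 HD'] := Hb j.
have [D [k' [D0 Dle hD]]] := refine_error r0 t0 D'0.
exists D => // mu hg N x Nj.
have hg' := good_coarse t200 hg D0 Dle hD.
have [M0' HM0'] := HD' _ hg' j 0 (leqnn j).
exists (absz x + (n * s * j + 4 * (n * s) * (M0' + 2)))%N => M hM.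
rewrite addnS -addSn; apply: (le_trans (HM0' _ (leqnn _))).
have := @renormalize R mu n s k' t%:R (cost t) (good_law hg) n0 (tau_ge0 t200)
  (fun p _ => cost_ge1 t200 p) (cost_le t200) M M0' j N
  (fun y => x <= y <= x + (4 * (n * s) * b'.+1)%:Z) x.
have hN : (N <= r * j)%N by apply: (leq_trans Nj); rewrite leq_pmull.
move=> /(_ hN) hc; apply: le_trans (hc _); last by move: hM; lia.
apply: survival_increasing; first exact: good_law hg'.
move=> J /andP[J0 Jb]; rewrite add0r in Jb.
apply/allP => g gs; have [_ sg] := slotsP gs.
have [k0 k0g] : exists k0, k0 \in g by move: sg; case: (g) => [|i g'] /=; [lia|exists i; rewrite mem_head].
apply/hasP; exists k0 => //; have klt := slots_lt gs k0g.
have h1 : 0 <= (4 * (n * s))%:Z * J by rewrite mulr_ge0.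
have h2 : (4 * (n * s))%:Z * J <= (4 * (n * s))%:Z * b'%:Z by apply: ler_wpM2l.
move: h1 h2 klt; rewrite mulnS PoszD PoszM; move: (n * s)%N => q h1 h2 klt.
by apply/andP; split; move: h1 h2 klt; clear; lia.
Qed.

End GoodLaws.

Local Open Scope classical_set_scope.

(** * The environment *)

Section BaseLaw.
Context {R : realType}.
Variables (rho p : R).
Hypotheses (rho01 : 0 <= rho <= 1) (p0 : 0 < p) (p1 : p <= 1).

Definition column (m : nat) : R := (p ^+ m.+1)^-1.

Fixpoint columns (x : int -> nat) (T N : nat) : seq R :=
  if N is N'.+1 then column (x T%:Z) :: columns x T.+1 N' else [::].

Lemma columns_add x T N N' : columns x T (N + N') = columns x T N ++ columns x (T + N) N'.
Proof. by elim: N T => [|N IH] T /=; rewrite ?addn0 // IH addnS. Qed.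

Lemma size_columns x T N : size (columns x T N) = N.
Proof. by elim: N T => //= N IH T; rewrite IH. Qed.

Definition base_law (C : nat) (f : R -> R) : R :=
  \sum_(m < C) (1 - rho) * rho ^+ m * f (column m).

Let rho0 : 0 <= rho. Proof. by case/andP: rho01. Qed.
Let rho1 : rho <= 1. Proof. by case/andP: rho01. Qed.

Lemma column_ge1 m : 1 <= column m.
Proof. by rewrite /column invf_ge1 ?exprn_gt0 // exprn_ile1 // ltW. Qed.

Lemma ge1_columns x T N : ge1 (columns x T N).
Proof. by elim: N T => //= N IH T; rewrite IH column_ge1. Qed.

Lemma base_law_mass C : base_law C (fun _ => 1) = 1 - rho ^+ C.
Proof.
rewrite /base_law; elim: C => [|C IH]; first by rewrite big_ord0 expr0 subrr.
by rewrite big_ord_recr /= IH exprS; ring.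
Qed.

Lemma base_law_law C : law (base_law C).
Proof.
split.
- by move=> f g; rewrite -big_split; apply: eq_bigr => m _; rewrite mulrDr.
- by move=> a f; rewrite /base_law mulr_sumr; apply: eq_bigr => m _; rewrite mulrCA.
- move=> f g fg; apply: ler_sum => m _; apply: ler_wpM2l; last exact/fg/column_ge1.
  by rewrite mulr_ge0 ?subr_ge0 // exprn_ge0.
- by rewrite base_law_mass gerBl exprn_ge0.
Qed.

(** The moment is a partial geometric sum of ratio [rho * w]; the last hypothesis bounds each term
    by a difference of consecutive powers. *)
Lemma base_law_moment C (w eta : R) : w = (p ^+ 8)^-1 -> 0 <= eta ->
  rho * w <= 1 -> (1 - rho) * w <= (1 + eta) * (1 - rho * w) ->
  base_law C (fun z => z ^+ 8) <= 1 + eta.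
Proof.
move=> ew eta0 rw1 h.
have w0 : 0 <= w by rewrite ew invr_ge0 exprn_ge0 // ltW.
apply: (@le_trans _ _ ((1 + eta) * (1 - (rho * w) ^+ C))); last first.
  by rewrite ler_piMr ?gerBl ?exprn_ge0 ?mulr_ge0 // addr_ge0.
rewrite /base_law; elim: C => [|C IH]; first by rewrite big_ord0 expr0 subrr mulr0.
rewrite big_ord_recr /=; apply: (le_trans (lerD IH (lexx _))).
have -> : column C ^+ 8 = w * w ^+ C.
  by rewrite /column ew -exprS !exprVn -!exprM mulnC.
have rw0 : 0 <= (rho * w) ^+ C by rewrite exprn_ge0 // mulr_ge0.
have := ler_wpM2r rw0 h; rewrite exprS exprMn.
by set A := rho ^+ C; set B := w ^+ C; lra.
Qed.

(** The excess of the moment is a small multiple of [delta], and even [40 * delta] is below the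
    tolerance [200 ^- 8] of the first level. The truncation [C] only has to make the missing mass at
    most [D]. *)
Lemma base_law_good (delta D : R) C : delta <= 10 ^- 30 ->
  1 - delta <= p ^+ 4 -> rho <= delta -> rho ^+ C <= D ->
  good 200 D (base_law C).
Proof.
move=> d30 pd rd CD.
have d0 : 0 <= delta by apply: le_trans rd.
have small : 40 * 10 ^- 30 <= (200 : R) ^- 8.
  rewrite ler_pdivrMr ?exprn_gt0 // mulrC ler_pdivlMr ?exprn_gt0 //; lra.
have dsm : delta <= 1 / 1000 by apply: (le_trans d30); rewrite -[leLHS]mul1r ler_pdivrMr ?exprn_gt0 //; lra.
split; first exact: base_law_law.
  by rewrite base_law_mass lerD2l lerN2.
have p8 : 1 - 2 * delta <= p ^+ 8.
  rewrite (exprD p 4 4); have := ler_pM _ _ pd pd; rewrite subr_ge0 => h.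
  have {}h := h _ _; apply: le_trans (h _ _); [have := mulr_ge0 d0 d0|..]; lra.
set w := (p ^+ 8)^-1.
have p8_0 : 0 < p ^+ 8 by rewrite exprn_gt0.
have wle : w <= 1 + 4 * delta.
  rewrite /w -[leLHS]mul1r ler_pdivrMr //.
  apply: (@le_trans _ _ ((1 + 4 * delta) * (1 - 2 * delta))).
    have : delta * delta <= delta * (1 / 1000) by apply: ler_wpM2l.
    lra.
  by apply: ler_wpM2l => //; lra.
have w0 : 0 <= w by rewrite invr_ge0 ltW.
have rw : rho * w <= 2 * delta.
  apply: (@le_trans _ _ (delta * 2)); last by lra.
  by apply: ler_pM => //; lra.
apply: (@base_law_moment C w) => //; first by lra.
set eta := _ ^- 8 in small *.
have eta1 : eta <= 1 by rewrite /eta invf_le1 ?exprn_gt0 // exprn_ege1 //; lra.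
apply: (@le_trans _ _ w); first by rewrite ler_piMl // gerBl.
have e40 : 40 * delta <= eta by apply: le_trans small; lra.
apply: (@le_trans _ _ ((1 + eta) * (1 - 2 * delta))).
  have : eta * delta <= 1 * delta by apply: ler_wpM2r.
  lra.
by apply: ler_wpM2l; lra.
Qed.

End BaseLaw.

Section Environment.
Context {R : realType} (d0 : measure_display) (Om0 : measurableType d0)
  (Q : probability Om0 R) (xi : int -> Om0 -> nat) (rho p : R).
Hypotheses (rho01 : 0 <= rho <= 1) (p0 : 0 < p) (p1 : p <= 1)
  (iid : iid_geometric Q xi rho).

Local Notation cols T N w := (columns p (fun i => xi i w) T N).

Let mxi i (B : set nat) : measurable (xi i @^-1` B).
Proof. by case: iid. Qed.

Lemma geometric_mass i m : Q (xi i @^-1` [set m]) = ((1 - rho) * rho ^+ m)%:E.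
Proof.
have [_ _ geo] := iid.
have -> : xi i @^-1` [set m] = [set w | (m <= xi i w)%N] `\` [set w | (m.+1 <= xi i w)%N].
  apply/seteqP; split => w /=.
    by move=> ->; rewrite leqnn ltnn; split.
  by move=> [h1 /negP]; rewrite -leqNgt => h2; apply/eqP; rewrite eqn_leq h1 h2.
have m1 k : measurable [set w | (k <= xi i w)%N] by exact: (mxi i [set j | (k <= j)%N]).
rewrite measureD //; last by apply: le_lt_trans (probability_le1 Q _) _ => //; rewrite ltry.
have -> : [set w | (m <= xi i w)%N] `&` [set w | (m < xi i w)%N] = [set w | (m < xi i w)%N].
  by apply/seteqP; split => w /= [] // h; split => //; exact: ltnW.
transitivity ((rho ^+ m)%:E - (rho ^+ m.+1)%:E)%E; first by congr (_ - _)%E; exact: geo.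
by rewrite -EFinB exprS; congr EFin; ring.
Qed.

(** Finitely many columns take countably many values, so any property of them is measurable. *)
Lemma columns_measurable N T (P : seq R -> Prop) : measurable [set w | P (cols T N w)].
Proof.
elim: N T P => [|N IH] T P /=.
  have [h|h] := pselect (P [::]).
    by rewrite (_ : [set _ | _] = setT) //; apply/seteqP; split.
  by rewrite (_ : [set _ | _] = set0) //; apply/seteqP; split.
have -> : [set w | P (column p (xi T w) :: cols T.+1 N w)] =
  \bigcup_m (xi T @^-1` [set m] `&` [set w | P (column p m :: cols T.+1 N w)]).
  apply/seteqP; split => w /=; first by move=> h; exists (xi T w).
  by move=> [m _ [/= ->]].
apply: bigcupT_measurable => m; apply: measurableI; [exact: mxi|].
exact: (IH T.+1 (fun l => P (column p m :: l))).
Qed.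

(** Columns are fixed one after another; [s] and [B] record the conditions already imposed, to which
    the independence of the [xi i] applies. Values from [C] on are dropped, hence an inequality. *)
Lemma columns_prob (C : nat) (P : seq R -> bool) N T (s : seq int) (B : int -> set nat) :
  uniq s -> (forall k : nat, (T <= k)%N -> k%:Z \notin s) ->
  (Q (\big[setI/setT]_(i <- s) (xi i @^-1` B i)) *
     (iid_exp (base_law rho p C) N (fun l => (P l)%:R))%:E <=
   Q (\big[setI/setT]_(i <- s) (xi i @^-1` B i) `&` [set w | P (cols T N w)]))%E.
Proof.
have [_ ind _] := iid.
elim: N T s B P => [|N IH] T s B P us Ts.
  rewrite /=; case: (P [::]).
    by rewrite mule1 (_ : [set _ | _] = setT) ?setIT //; apply/seteqP; split.
  by rewrite mule0.
set K := \big[setI/setT]_(i <- s) _.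
have mK : measurable K by apply: bigsetI_measurable => i _; exact: mxi.
pose F m := K `&` (xi T @^-1` [set m] `&` [set w | P (column p m :: cols T.+1 N w)]).
have mF m : measurable (F m).
  apply: measurableI => //; apply: measurableI; first exact: mxi.
  exact: (columns_measurable N T.+1 (fun l => P (column p m :: l))).
have tF : trivIset setT F.
  by apply/trivIsetP => i j _ _ ij; apply/seteqP; split => // w /= [[_ [/= e1 _]] [_ [/= e2 _]]];
    move: ij; rewrite -e1 -e2 eqxx.
apply: (@le_trans _ _ (Q (\big[setU/set0]_(m < C) F m))); last first.
  apply: le_measure; rewrite ?inE.
  - exact: bigsetU_measurable.
  - by apply: measurableI => //; exact: (columns_measurable N.+1 T P).
  - rewrite -bigcup_mkord => w [m _ [Kw [/= e h]]]; split => //=.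
    by rewrite e.
rewrite measure_bigsetU //.
set c := fun m => iid_exp (base_law rho p C) N (fun l => (P (column p m :: l))%:R).
have -> : iid_exp (base_law rho p C) N.+1 (fun l => (P l)%:R) =
   \sum_(m < C) (1 - rho) * rho ^+ m * c m by [].
have Kfin : Q K = (fine (Q K))%:E.
  by rewrite fineK //; exact: fin_num_measure.
rewrite Kfin -EFinM mulr_sumr -sumEFin; apply: lee_sum => m _.
have Tfresh : T%:Z \notin s by exact: Ts.
pose B' j := if j == T%:Z then [set nat_of_ord m] else B j.
have eK : \big[setI/setT]_(i <- T%:Z :: s) (xi i @^-1` B' i) = xi T @^-1` [set nat_of_ord m] `&` K.
  rewrite big_cons /B' eqxx; congr (_ `&` _); rewrite /K !big_seq.
  by apply: eq_bigr => i iis; case: eqP => // e; rewrite -e iis in Tfresh.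
have uTs : uniq (T%:Z :: s) by rewrite /= Tfresh.
have := IH T.+1 (T%:Z :: s) B' (fun l => P (column p m :: l)) uTs.
have fresh k : (T.+1 <= k)%N -> k%:Z \notin T%:Z :: s.
  move=> Tk; rewrite inE negb_or Ts ?(ltnW Tk) // andbT.
  by apply/eqP => -[e]; rewrite e ltnn in Tk.
move=> /(_ fresh).
have -> : Q (\big[setI/setT]_(i <- T%:Z :: s) (xi i @^-1` B' i)) =
    (((1 - rho) * rho ^+ m)%:E * Q K)%E.
  rewrite (ind _ B' uTs) big_cons {1}/B' eqxx geometric_mass; congr (_ * _)%E.
  rewrite /K (ind _ B us) !big_seq; apply: eq_bigr => i iis.
  by rewrite /B'; case: eqP => // e; rewrite -e iis in Tfresh.
rewrite eK Kfin -/(c m) => h.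
have -> : F m = xi T @^-1` [set nat_of_ord m] `&` K `&` [set w | P (column p m :: cols T.+1 N w)].
  by rewrite /F setIA [K `&` _]setIC.
apply: le_trans h.
by rewrite -!EFinM lee_fin mulrA [fine _ * _]mulrC.
Qed.

(* The window [M] may depend on the horizon [N]. *)
Definition surviving T b N (w : Om0) : Prop :=
  exists2 M : nat, (b <= M)%N &
    1 / 2 <= quenched_exp M (cols T N w) (fun y => 0 <= y <= b%:Z) alive.

Lemma surviving_prob (delta : R) k : delta <= 10 ^- 30 -> 1 - delta <= p ^+ 4 ->
  rho <= delta -> exists b, forall T N,
  ((1 - 2 * (200 + k)%:R^-1)%:E <= Q [set w | surviving T b N w])%E.
Proof.
move=> d30 pd rd; have [b Hb] := @survive_interval R k 200 (leqnn 200).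
exists b => T N; have [D D0 HD] := Hb N.
have [C hC] : exists C, rho ^+ C <= D.
  have rho2 : rho <= 1 / 2.
    by apply: (le_trans rd); apply: (le_trans d30); rewrite -[leLHS]mul1r ler_pdivrMr ?exprn_gt0 //; lra.
  have [m hm] : exists m : nat, D^-1 < m%:R.
    by eexists; apply: archi_boundP; rewrite invr_ge0 ltW.
  have /andP[r0 _] := rho01.
  exists m; apply: (@le_trans _ _ ((1 / 2) ^+ m)).
    by apply: lerXn2r => //; rewrite nnegrE; lra.
  rewrite div1r exprVn -[leRHS]invrK lef_pV2 ?posrE ?exprn_gt0 ?invr_gt0 //.
  apply: (le_trans (ltW hm)); rewrite -natrX ler_nat.
  exact: ltnW (ltn_expl m (ltnSn 1)).
have hg := base_law_good rho01 p0 p1 d30 pd rd hC.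
have hmu := good_law hg.
have [M0 HM0] := HD _ hg N 0 (leqnn N).
pose M := maxn M0 b.
have := HM0 M (leq_maxl _ _); rewrite -[N in survival _ _ N]addn0 (survival_addn hmu) => hU.
have bM : (b <= M)%N by exact: leq_maxr.
pose A (y : int) := 0 <= y <= b%:Z.
pose P (l : seq R) : bool := `[< exists2 M : nat, (b <= M)%N & 1 / 2 <= quenched_exp M l A alive >].
have := @columns_prob C P N T [::] (fun _ => setT) isT (fun k _ => isT).
rewrite big_nil probability_setT mul1e setTI.
have -> : [set w | P (cols T N w)] = [set w | surviving T b N w].
  by apply/seteqP; split => w /=; rewrite /P => /asboolP.
apply: le_trans; rewrite lee_fin.
(* Markov's inequality: for [S <= 1], [2 * S - 1] is at most the indicator of [1 / 2 <= S]. *)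
apply: (@le_trans _ _ (iid_exp (base_law rho p C) N (fun l => 2 * quenched_exp M l A alive + (- 1) * 1))).
  rewrite (iid_expD hmu) !(iid_expZ hmu).
  have h1 : iid_exp (base_law rho p C) N (fun _ => 1) <= 1 by apply: (iid_exp_le1 hmu).
  have eA : (fun y : int => 0 <= y <= 0 + b%:Z) = A by apply/funext => y; rewrite add0r.
  rewrite eA in hU.
  have hU' : 1 - (200 + k)%:R^-1 <= iid_exp (base_law rho p C) N (fun l => quenched_exp M l A alive) := hU.
  by lra.
apply: (iid_exp_le hmu) => l _ l1; have HE := spacetime_prodexp M l1.
have S1 : quenched_exp M l A alive <= 1.
  by rewrite quenched_spacetime; apply: (pe_le1 HE) => c; have /andP[] := @alive01 R (occupied A c (size l)).
rewrite /P; case: asboolP => h; first by rewrite /=; lra.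
have : quenched_exp M l A alive < 1 / 2.
  by rewrite ltNge; apply/negP => h'; apply: h; exists M.
by rewrite /=; lra.
Qed.

Lemma surviving_S T b N w : surviving T b N.+1 w -> surviving T b N w.
Proof.
move=> [M bM hM]; exists M => //; apply: (le_trans hM).
rewrite -addn1 columns_add quenched_cat; apply: quenched_le; first exact: ge1_columns.
move=> A /=; have z1 := column_ge1 p0 p1 (xi (T + N)%N w).
exact: next_alive_le.
Qed.

End Environment.

(** * Bond percolation *)

Section Filling.
Context {R : realType}.
Implicit Types (A : int -> bool) (l : seq R).

Lemma coin_exp_force (X : eqType) (q : R) (s s' : seq X) f :
  0 <= q <= 1 -> uniq s -> uniq s' -> {subset s' <= s} ->
  (forall c, 0 <= f c) -> increasing f ->
  q ^+ size s' * f (fun x => x \in s') <= coin_exp q s f.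
Proof.
move=> q01 us us' ss f0 incf; have HE := coin_exp_prodexp s q01.
have -> : q ^+ size s' = coin_exp q s (fun c => (all c s')%:R).
  rewrite (pe_all HE (w := fun _ => q)) //; last by move=> x /ss; exact: coin_exp_mem.
  by rewrite big_const_seq count_predT; elim: (size s') => //= m <-; rewrite exprS.
rewrite mulrC -(peZ HE); apply: (pe_le HE) => c.
case: allP => h; last by rewrite mulr0.
by rewrite mulr1; apply: incf => x /h.
Qed.

Definition fill_prob (b : nat) l : R := \prod_(z <- l) z^-1 ^+ b.+1.

Lemma fill_prob_gt0 b l : ge1 l -> 0 < fill_prob b l.
Proof.
move=> /allP l1; rewrite /fill_prob big_seq; apply: prodr_gt0 => z /l1 z1.
by rewrite exprn_gt0 // invr_gt0 (lt_le_trans ltr01).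
Qed.

(** Forcing the coins of [[0, k + 1]] lengthens the occupied interval by one per column, and takes
    at most [b + 1] coins in each. *)
Lemma quenched_fill M b l f k : (b <= M)%N -> ge1 l -> (k + size l <= b)%N ->
  (forall A, 0 <= f A) -> increasing f ->
  fill_prob b l * f (fun y => 0 <= y <= (k + size l)%:Z) <=
    quenched_exp M l (fun y => 0 <= y <= k%:Z) f.
Proof.
move=> bM + + f0 incf; rewrite /fill_prob.
elim: l k => [|z l IH] k; first by rewrite big_nil mul1r addn0.
move=> /= /andP[z1 l1] kb; rewrite big_cons -mulrA.
have /andP[i0 i1] := inv01 z1.
have F0 : 0 <= \prod_(z <- l) z^-1 ^+ b.+1 by apply: ltW; exact: (fill_prob_gt0 b l1).
have {}IH := IH k.+1 l1 _; rewrite addSnnS in IH.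
apply: (le_trans (ler_wpM2l _ (IH kb))); first by rewrite exprn_ge0.
pose g (c : int -> bool) := quenched_exp M l (next (fun y => 0 <= y <= k%:Z) c) f.
have g0 c : 0 <= g c.
  by rewrite /g quenched_spacetime; apply: (pe_ge0 (spacetime_prodexp M l1)) => c'.
have incg : increasing g.
  move=> c c' cc'; apply: quenched_increasing => // y; exact: next_mono.
pose s' := [seq i%:Z | i <- iota 0 k.+2].
have us' : uniq s' by rewrite map_inj_uniq ?iota_uniq // => i j [].
have := @coin_exp_force _ z^-1 (window M) s' g (inv01 z1) (window_uniq M) us' _ g0 incg.
have ss : {subset s' <= window M}.
  by move=> y /mapP[i]; rewrite mem_iota mem_window => ik ->; move: kb; lia.
move=> /(_ ss); rewrite size_map size_iota; apply: le_trans.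
have gs : quenched_exp M l (fun y => 0 <= y <= k.+1%:Z) f <= g (fun x => x \in s').
  apply: quenched_increasing => // y yk; rewrite /next; apply/andP; split; last by lia.
  by apply/mapP; exists (absz y); [rewrite mem_iota; lia|lia].
apply: ler_pM => //.
- by rewrite exprn_ge0.
- by rewrite quenched_spacetime; apply: (pe_ge0 (spacetime_prodexp M l1)) => c'.
- by apply: ler_wiXn2l => //; lia.
Qed.

End Filling.

(** * From sites to bonds, and from finite to infinite paths *)

Section BondPercolation.
Context {R : realType} (d : measure_display) (Om : measurableType d)
  (P : probability Om R) (omega : edge -> Om -> bool) (p : R) (xi : int -> nat).
Hypotheses (p0 : 0 < p) (p1 : p <= 1) (hP : percolation_law P omega p xi).

(* In the coordinates [(i, y) = (i, (i + j) / 2)] the two edges leaving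
   [(i, y)] lead to [(i + 1, y)] and [(i + 1, y + 1)]. *)
Definition site (i : nat) (y : int) : vertex := (i%:Z, 2 * y - i%:Z).
Definition bond (i : nat) (y y' : int) : edge := (site i y, site i.+1 y').

Lemma bond_in_E i y y' : y' = y \/ y' = y + 1 -> in_E (bond i y y').
Proof.
move=> h; rewrite /in_E /in_V /= /site /=.
have e z (k : int) : ((k + (2 * z - k)) %% 2)%Z = 0.
  by rewrite addrC subrK; lia.
by rewrite !e !eqxx /=; case: h => ->; lia.
Qed.

Fixpoint conn (N i : nat) (y : int) : set Om :=
  if N is N'.+1 then
    ([set w | omega (bond i y y) w] `&` conn N' i.+1 y) `|`
    ([set w | omega (bond i y (y + 1)) w] `&` conn N' i.+1 (y + 1))
  else setT.

Let momega e : in_E e -> measurable [set w | omega e w].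
Proof. by case: hP => h _ _; exact: h. Qed.

Lemma conn_measurable N i y : measurable (conn N i y).
Proof.
elim: N i y => [|N IH] i y //=; apply: measurableU; apply: measurableI => //.
  by apply: momega; apply: bond_in_E; left.
by apply: momega; apply: bond_in_E; right.
Qed.

Lemma conn_step N i y y' w : y' = y \/ y' = y + 1 ->
  omega (bond i y y') w -> conn N i.+1 y' w -> conn N.+1 i y w.
Proof. by case=> ->; [left|right]. Qed.

Fixpoint pattern (tau : seq (edge * bool)) : set Om :=
  if tau is (e, b) :: tau' then [set w | omega e w = b] `&` pattern tau' else setT.

Definition edge_prob (e : edge) : R := p ^+ (xi e.1.1).+1.

Definition pattern_prob (tau : seq (edge * bool)) : R :=
  \prod_(x <- tau) (if x.2 then edge_prob x.1 else 1 - edge_prob x.1).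

Definition valid_pattern (tau : seq (edge * bool)) := uniq (unzip1 tau) && all in_E (unzip1 tau).

Lemma pattern_measurable tau : all in_E (unzip1 tau) -> measurable (pattern tau).
Proof.
elim: tau => [|[e b] tau IH] //= /andP[eE /IH mt]; apply: measurableI => //.
case: b; first exact: momega.
have -> : [set w | omega e w = false] = ~` [set w | omega e w].
  by apply/seteqP; split => w /=; [move=> ->|move=> /negP/negbTE].
by apply: measurableC; exact: momega.
Qed.

(** Independence is assumed for open edges. Closed edges are reduced to it one at a time by
    subtracting the event that the edge is open; [s] collects the edges required to be open. *)
Lemma open_pattern_prob tau (s : seq edge) :
  uniq (s ++ unzip1 tau) -> all in_E (s ++ unzip1 tau) ->
  P (\big[setI/setT]_(e <- s) [set w | omega e w] `&` pattern tau) =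
  (\prod_(e <- s) edge_prob e * pattern_prob tau)%:E.
Proof.
have [_ ind pr] := hP.
elim: tau s => [|[e b] tau IH] s.
  rewrite cats0 /= setIT => us sE; rewrite /pattern_prob big_nil mulr1 ind // -prodEFin.
  by rewrite !big_seq; apply: eq_bigr => e es; rewrite pr //; exact: (allP sE).
move=> us sE.
have perm : perm_eq (s ++ e :: unzip1 tau) (e :: s ++ unzip1 tau).
  by rewrite perm_sym -cat1s perm_catCA.
have us' : uniq (e :: s ++ unzip1 tau) by rewrite -(perm_uniq perm).
have sE' : all in_E (e :: s ++ unzip1 tau) by rewrite -(perm_all _ perm).
have eE : in_E e by move: sE' => /= /andP[].
have sE'' : all in_E (s ++ unzip1 tau) by move: sE' => /= /andP[].
have tE : all in_E (unzip1 tau) by move: sE''; rewrite all_cat => /andP[].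
have IHe := IH (e :: s) us' sE'; rewrite !big_cons in IHe.
rewrite /pattern_prob big_cons -/(pattern_prob tau) /=.
clear us sE; case: b.
  by rewrite setICA setIA IHe; congr EFin; ring.
have IHs := IH s (subseq_uniq (subseq_cons _ e) us') sE''.
have mX : measurable (\big[setI/setT]_(e <- s) [set w | omega e w] `&` pattern tau).
  apply: measurableI; last exact: pattern_measurable.
  rewrite big_seq; apply: bigsetI_measurable => x xs; apply: momega.
  by apply: (allP sE''); rewrite mem_cat xs.
set X := _ `&` pattern tau in IHs mX.
have -> : \big[setI/setT]_(e <- s) [set w | omega e w] `&`
    ([set w | omega e w = false] `&` pattern tau) = X `\` [set w | omega e w].
  apply/seteqP; split => w /=; rewrite /X /=.
    by move=> [h1 [h2 h3]]; split => //; rewrite h2.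
  by move=> [[h1 h3] /negP/negbTE h2].
rewrite measureD //; [|exact: momega|].
  have -> : X `&` [set w | omega e w] =
    [set w | omega e w] `&` \big[setI/setT]_(e <- s) [set w | omega e w] `&` pattern tau.
    by rewrite /X setIC setIA.
  rewrite [X in (X - _)%E = _]IHs [X in (_ - X)%E = _]IHe -EFinB; congr EFin; ring.
by apply: le_lt_trans (probability_le1 P _) _ => //; rewrite ltry.
Qed.

Lemma pattern_probE tau : valid_pattern tau -> P (pattern tau) = (pattern_prob tau)%:E.
Proof.
move=> /andP[ut tE]; have := @open_pattern_prob tau [::] ut tE.
by rewrite !big_nil setTI mul1r.
Qed.

Lemma pattern_split tau e (Ev : set Om) : in_E e -> all in_E (unzip1 tau) -> measurable Ev ->
  (P (pattern ((e, true) :: tau) `&` Ev) + P (pattern ((e, false) :: tau) `&` Ev) =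
   P (pattern tau `&` Ev))%E.
Proof.
move=> eE tE mE; rewrite -measureU //.
- congr (P _); apply/seteqP; split => w /=; first by move=> [[[_ h] ?]|[[_ h] ?]].
  by move=> [h1 h2]; case e1: (omega e w); [left|right].
- by apply: measurableI => //; apply: pattern_measurable; rewrite /= eE.
- by apply: measurableI => //; apply: pattern_measurable; rewrite /= eE.
- by apply/seteqP; split => w //= [[[-> _] _] [[]]].
Qed.

(* [tau] only reveals edges leaving columns before [i], or edges of column [i]
   whose endpoint is not among the sites [ys] still to be examined. *)
Definition fresh (i : nat) (ys : seq int) (tau : seq (edge * bool)) : Prop :=
  forall x, x \in tau -> x.1.1.1 < i%:Z \/
    x.1.1.1 = i%:Z /\ forall y, y \in ys -> x.1.2.2 != 2 * y - i.+1%:Z.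

(* For each site next to an occupied one a single incoming edge, from an occupied
   site, is revealed. *)
Lemma site_le_bond M N i (A : int -> bool) tau (Ev : set Om) : measurable Ev ->
  valid_pattern tau -> fresh i (window M) tau ->
  (forall y, A y -> pattern tau `&` conn N i y `<=` Ev) ->
  ((pattern_prob tau * quenched_exp M (columns p xi i N) A alive)%:E <= P (pattern tau `&` Ev))%E.
Proof.
move=> mE; elim: N i A tau => [|N IH] i A tau tt ft hA.
  rewrite /= /alive; case: asboolP => [[y Ay]|_].
    have := hA y Ay; rewrite /= setIT => h.
    by rewrite mulr1 -pattern_probE // (setIidl h).
  by rewrite mulr0.
rewrite [quenched_exp _ _ _ _]/=; set q := (column p (xi i))^-1.
have qE y y' : edge_prob (bond i y y') = q by rewrite /q /column invrK.
have := window_uniq M; move: (window M) ft => ys.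
pose nb y := A y || A (y - 1).
(* Sites of the next column are examined one by one: [acc] holds those found occupied so far, [ys]
   those still to come. *)
suff step : forall (acc : int -> bool) tau, valid_pattern tau -> uniq ys -> fresh i ys tau ->
    (forall y, A y -> pattern tau `&` conn N.+1 i y `<=` Ev) ->
    (forall y, acc y -> pattern tau `&` conn N i.+1 y `<=` Ev) ->
    ((pattern_prob tau * coin_exp q ys (fun c => quenched_exp M (columns p xi i.+1 N)
        (fun y => acc y || (c y && nb y)) alive))%:E <= P (pattern tau `&` Ev))%E.
  move=> ft uys; apply: (step (fun _ => false)) => //.
clear tau tt hA; elim: ys => [|y ys IHy] acc tau tt.
  move=> _ ft _ hacc; rewrite /coin_exp.
  have -> : (fun y => acc y || (false && nb y)) = acc by apply/funext => y; rewrite orbF.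
  apply: IH => // x /ft[h|[h _]]; left; rewrite ?h; lia.
move=> /= /andP[yys uys] ft hA hacc.
have ft' : fresh i ys tau.
  move=> x /ft[|[h1 h2]]; [by left|right; split => // z zys; apply: h2].
  by rewrite inE zys orbT.
rewrite coin_exp_cons.
(* Without an occupied predecessor the coin of [y] has no effect and no edge is revealed. *)
case nby: (nb y); last first.
  have -> : (fun c : int -> bool => quenched_exp M (columns p xi i.+1 N)
      (fun z => acc z || (((z == y) || c z) && nb z)) alive) =
    (fun c : int -> bool => quenched_exp M (columns p xi i.+1 N) (fun z => acc z || (c z && nb z)) alive).
    apply/funext => c; congr (quenched_exp _ _ _ _); apply/funext => z.
    by case: eqP => // ->; rewrite nby !andbF.
  by rewrite -mulrDl addrC subrK mul1r; apply: IHy.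
pose y0 := if A y then y else y - 1.
have Ay0 : A y0 by rewrite /y0; move: nby; rewrite /nb; case: ifP.
have yy0 : y = y0 \/ y = y0 + 1 by rewrite /y0; case: ifP => _; [left|right; rewrite subrK].
pose e := bond i y0 y.
have eE : in_E e by apply: bond_in_E.
have /andP[ut tE] := tt.
have ety : e \notin unzip1 tau.
  apply/negP => /mapP[x xt ex]; have := ft x xt; rewrite -ex /=.
  by case=> [|[_ /(_ y (mem_head _ _))]]; rewrite ?ltxx ?eqxx.
have tt' b : valid_pattern ((e, b) :: tau) by rewrite /valid_pattern /= ety ut eE.
have ft'' b : fresh i ys ((e, b) :: tau).
  move=> x; rewrite inE => /orP[/eqP ->|/ft' //]; right; split => //= z zys.
  have zy : z != y by apply: contraNneq yys => <-.
  by move: zy; clear; lia.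
have sub b : pattern ((e, b) :: tau) `<=` pattern tau by move=> w [].
rewrite -(@pattern_split tau e Ev) // mulrDr EFinD; apply: leeD.
- have := IHy (fun z => acc z || (z == y)) ((e, true) :: tau) (tt' true) uys (ft'' true).
  rewrite /pattern_prob big_cons -/(pattern_prob tau) /= qE.
  have -> : (fun c : int -> bool => quenched_exp M (columns p xi i.+1 N)
      (fun z => acc z || (((z == y) || c z) && nb z)) alive) =
    (fun c : int -> bool => quenched_exp M (columns p xi i.+1 N)
      (fun z => acc z || (z == y) || (c z && nb z)) alive).
    apply/funext => c; congr (quenched_exp _ _ _ _); apply/funext => z.
    by case: eqP => [->|_]; rewrite ?nby ?orbT ?orbF.
  rewrite mulrCA mulrA => h; apply: h.
    by move=> z Az w [pw cw]; apply: (hA z Az); split => //; exact: (sub true).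
  move=> z /orP[az|/eqP ->] w [pw cw].
    by apply: (hacc z az); split => //; exact: (sub true).
  apply: (hA y0 Ay0); split; first exact: (sub true).
  have [ew _] := pw; rewrite /= in ew.
  exact: conn_step yy0 ew cw.
- have := IHy acc ((e, false) :: tau) (tt' false) uys (ft'' false).
  rewrite /pattern_prob big_cons -/(pattern_prob tau) /= qE.
  rewrite mulrCA mulrA => h; apply: h.
    by move=> z Az w [pw cw]; apply: (hA z Az); split => //; exact: (sub false).
  by move=> z az w [pw cw]; apply: (hacc z az); split => //; exact: (sub false).
Qed.

Lemma conn_ge M N : ((quenched_exp M (columns p xi 0 N) (pred1 0) alive)%:E <= P (conn N 0 0))%E.
Proof.
have := @site_le_bond M N 0 (pred1 0) [::] (conn N 0 0) (conn_measurable N 0 0) isT.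
rewrite /pattern_prob big_nil mul1r /= setTI; apply => //.
by move=> y /eqP -> w [].
Qed.

Lemma conn_S N i y : conn N.+1 i y `<=` conn N i y.
Proof.
elim: N i y => [|N IH] i y //= w [[h1 h2]|[h1 h2]]; [left|right]; split => //; exact: IH.
Qed.

Lemma conn_le N N' i y : (N <= N')%N -> conn N' i y `<=` conn N i y.
Proof.
move=> /subnK <-; elim: (N' - N)%N => // k IH w; rewrite addSn => /conn_S; exact: IH.
Qed.

(** König's lemma for two successors: if the first one fails at some depth [N0], monotonicity in
    depth makes the second one serve every depth. *)
Lemma conn_child i y w : (forall N, conn N i y w) ->
  exists y', (y' = y \/ y' = y + 1) /\ omega (bond i y y') w /\ forall N, conn N i.+1 y' w.
Proof.
move=> h.
have [h0|h0] := pselect (omega (bond i y y) w /\ forall N, conn N i.+1 y w).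
  by exists y; split; [left|].
have [N0 hN0] : exists N0, ~ (omega (bond i y y) w /\ conn N0 i.+1 y w).
  apply/existsNP => k; apply: h0; split; first by have [] := k 0%N.
  by move=> N; have [] := k N.
exists (y + 1); split; [by right|].
have key N : omega (bond i y (y + 1)) w /\ conn N i.+1 (y + 1) w.
  have [[h1 h2]|[h1 h2]] := h (maxn N N0).+1.
    by case: hN0; split => //; apply: conn_le h2; exact: leq_maxr.
  by split => //; apply: conn_le h2; exact: leq_maxl.
by split; [have [] := key 0%N|move=> N; have [] := key N].
Qed.

Lemma connected_bigcap : connected_to_infinity omega = \bigcap_N conn N 0 0.
Proof.
apply/seteqP; split => w.
  move=> [g [g0 hg]] N _.
  have gE k : exists y, g k = site k y /\ (g k.+1 = site k.+1 y \/ g k.+1 = site k.+1 (y + 1)).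
    elim: k => [|k [y [e1 e2]]].
      exists 0; split; first by rewrite g0 /site mulr0 subr0.
      have [/and4P[_ _ /eqP h1 /orP h2] _] := hg 0%N; rewrite g0 /= in h1 h2.
      rewrite (surjective_pairing (g 1%N)) h1 /site.
      by case: h2 => /eqP ->; [right|left]; congr pair; lia.
    have [y' ey'] : exists y', g k.+1 = site k.+1 y' by case: e2; eexists; eassumption.
    exists y'; split => //.
    have [/and4P[_ _ /eqP h1 /orP h2] _] := hg k.+1; rewrite ey' /= in h1 h2.
    rewrite (surjective_pairing (g k.+2)) h1 /site.
    by case: h2 => /eqP ->; [right|left]; congr pair; lia.
  have main k y : g k = site k y -> conn N k y w.
    elim: N k y => // N IH k y gk.
    have [y1 [e1 e2]] := gE k.
    have yy1 : y1 = y by move: e1; rewrite gk /site => -[]; lia.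
    rewrite {}yy1 in e1 e2.
    have [_ ow] := hg k; rewrite /= in ow.
    by case: e2 => e2; [left|right]; split; rewrite ?e2; try exact: IH;
      rewrite /= /bond -e1 -e2.
  by apply: main; rewrite g0 /site mulr0 subr0.
move=> h.
pose S := {x : nat * int | forall N, conn N x.1 x.2 w}.
have h0 : forall N, conn N (0%N, 0 : int).1 (0%N, 0 : int).2 w by move=> N; exact: h.
have nxt (x : S) : {x' : S | (sval x').1 = (sval x).1.+1 /\
    ((sval x').2 = (sval x).2 \/ (sval x').2 = (sval x).2 + 1) /\
    omega (bond (sval x).1 (sval x).2 (sval x').2) w}.
  apply: cid; case: x => -[i y] /= hx; have [y' [e1 [e2 e3]]] := conn_child hx.
  by exists (exist _ (i.+1, y') e3).
pose G := fix G n : S := if n is n'.+1 then sval (nxt (G n')) else exist _ (0%N, 0) h0.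
have G1 n : (sval (G n)).1 = n.
  by elim: n => //= n IH; have [-> _] := svalP (nxt (G n)); rewrite IH.
exists (fun n => site n (sval (G n)).2); split; first by rewrite /= /site mulr0 subr0.
move=> n; have [_ [e2 e3]] := svalP (nxt (G n)).
move: e2 e3; rewrite -[sval (nxt (G n))]/(G n.+1) G1 => e2 e3.
by split => //; exact: bond_in_E.
Qed.

Lemma connected_pos (c : R) : 0 < c -> (forall N, (c%:E <= P (conn N 0 0))%E) ->
  (0 < P (connected_to_infinity omega))%E.
Proof.
move=> c0 hc; rewrite connected_bigcap.
have mc N : measurable (conn N 0 0) by exact: conn_measurable.
have cv : P \o (fun N => conn N 0 0) @ \oo --> P (\bigcap_N conn N 0 0).
  apply: nonincreasing_cvg_mu => //.
  - by apply: le_lt_trans (probability_le1 P _) _ => //; rewrite ltry.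
  - exact: bigcapT_measurable.
  - by move=> N N' NN'; apply/subsetPset; exact: conn_le.
apply: (@lt_le_trans _ _ c%:E); first by rewrite lte_fin.
rewrite -(cvg_lim _ cv) //; apply: lime_ge; first by apply/cvg_ex; eexists; exact: cv.
by apply: nearW => N; exact: hc.
Qed.

End BondPercolation.

(** In the first [b] columns the origin fills [[0, b]] with probability at least [fill_prob]; from
    column [b] on the interval survives with probability at least 1/2. The window varies with [N],
    but this lower bound does not. *)
Lemma surviving_percolates (R : realType) (p : R) (b : nat) (d0 : measure_display)
    (Om0 : measurableType d0) (xi : int -> Om0 -> nat) (w0 : Om0)
    (d : measure_display) (Om : measurableType d) (P : probability Om R)
    (omega : edge -> Om -> bool) :
  0 < p -> p <= 1 -> (forall N, surviving xi p b b N w0) ->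
  percolation_law P omega p (fun i => xi i w0) ->
  (0 < P (connected_to_infinity omega))%E.
Proof.
move=> p0 p1 surv hP; set x := fun i => xi i w0.
have z1 T N : ge1 (columns p x T N) by exact: ge1_columns.
have c0 : 0 < fill_prob b (columns p x 0 b) * (1 / 2).
  by rewrite mulr_gt0 ?fill_prob_gt0 //; lra.
apply: (connected_pos p0 p1 hP c0) => N; have [M bM hM] := surv N.
apply: (@le_trans _ _ (P (conn omega (b + N) 0 0))); last first.
  apply: le_measure; rewrite ?inE; [exact: (conn_measurable p0 p1 hP)..|].
  by apply: conn_le; exact: leq_addl.
apply: le_trans (conn_ge p0 p1 hP M (b + N)); rewrite lee_fin columns_add quenched_cat add0n.
pose f A := quenched_exp M (columns p x b N) A (@alive R).
have -> : (pred1 0 : int -> bool) = (fun y => 0 <= y <= 0%:Z).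
  by apply/funext => y /=; lia.
have f0 A : 0 <= f A.
  by rewrite /f quenched_spacetime; apply: (pe_ge0 (spacetime_prodexp M (z1 b N))) => c; have /andP[] := @alive01 R (occupied A c (size (columns p x b N))).
have incf : increasing f by apply: quenched_increasing => //; exact: alive_increasing.
have := @quenched_fill R M b (columns p x 0 b) f 0 bM (z1 0%N b) _ f0 incf.
rewrite size_columns add0n => /(_ (leqnn b)); apply: le_trans.
by apply: ler_wpM2l => //; apply: ltW; exact: fill_prob_gt0.
Qed.

Theorem theorem8p2 (R : realType) (rho p : R)
  (d0 : measure_display) (Om0 : measurableType d0) (Q : probability Om0 R)
  (xi : int -> Om0 -> nat) :
  0 <= rho <= 1 -> 0 <= p <= 1 ->
  rho <= Lcst ^- 16 ->
  (1 - Lcst ^- 10) `^ (4%:R^-1) <= p ->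
  iid_geometric Q xi rho ->
  {ae Q, forall w0 : Om0,
     forall (d : measure_display) (Om : measurableType d) (P : probability Om R)
            (omega : edge -> Om -> bool),
       percolation_law P omega p (fun i => xi i w0) ->
       (0 < P (connected_to_infinity omega))%E}.
Proof.
move=> rho01 /andP[p_ge0 p1] hrho hp iid.
have LE : Lcst = 10 ^+ 6 :> R by rewrite /Lcst natrX.
move: hrho hp LE; move: Lcst => L hrho hp LE.
have L1 : 1 <= L :> R by rewrite LE exprn_ege1 //; lra.
(* One small parameter bounds both [rho] and [1 - p ^+ 4]. *)
pose delta : R := L ^- 10.
have d30 : delta <= 10 ^- 30.
  rewrite /delta LE -exprM lef_pV2 ?posrE ?exprn_gt0 //.
  by apply: ler_weXn2l => //; lra.
have dhalf : delta <= 1 / 2.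
  by apply: (le_trans d30); rewrite -[leLHS]mul1r ler_pdivrMr ?exprn_gt0 //; lra.
have rd : rho <= delta.
  apply: (le_trans hrho); rewrite lef_pV2 ?posrE ?exprn_gt0 ?(lt_le_trans ltr01) //.
  exact: ler_weXn2l.
have pd : 1 - delta <= p ^+ 4.
  have -> : 1 - delta = ((1 - delta) `^ (4%:R^-1)) ^+ 4.
    rewrite -powR_mulrn ?powR_ge0 // -powRrM mulVf ?pnatr_eq0 // powRr1 //; lra.
  by apply: lerXn2r; rewrite ?nnegrE ?powR_ge0.
have p0 : 0 < p.
  rewrite lt_neqAle p_ge0 andbT; apply/eqP => p00; move: pd.
  by rewrite -p00 expr0n /=; lra.
have [b Hb] := choice (fun k => surviving_prob rho01 p0 p1 iid k d30 pd rd).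
(* Survival is started at column [b k], after the columns reserved for filling the interval of
   length [b k]. *)
pose H k N := [set w | surviving xi p (b k) (b k) N w].
have mH k N : measurable (H k N).
  exact: (columns_measurable p iid N (b k) (fun l => exists2 M : nat, (b k <= M)%N &
    1 / 2 <= quenched_exp M l (fun y => 0 <= y <= (b k)%:Z) alive)).
pose G k := \bigcap_N H k N.
have mG k : measurable (G k) by exact: bigcapT_measurable.
have QG k : ((1 - 2 * (200 + k)%:R^-1)%:E <= Q (G k))%E.
  have cv : Q \o H k @ \oo --> Q (G k).
    apply: nonincreasing_cvg_mu; [|exact: mH|exact: mG|].
    - by apply: le_lt_trans (probability_le1 Q _) _ => //; rewrite ltry.
    - move=> N N' /subnK <-; apply/subsetPset.
      by elim: (N' - N)%N => // k' IH w; rewrite addSn => /(surviving_S p0 p1); exact: IH.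
  rewrite -(cvg_lim _ cv) //; apply: lime_ge; first by apply/cvg_ex; eexists; exact: cv.
  by apply: nearW => N; exact: Hb.
(* A single good [k] suffices for percolation, and the complement of [G k] has probability at most
   [2 / (200 + k)], so the intersection is null. *)
exists (\bigcap_k ~` G k); split.
- by apply: bigcapT_measurable => k; exact: measurableC.
- apply/eqP; rewrite eq_le measure_ge0 andbT; apply/lee_addgt0Pr => e e0.
  rewrite add0e.
  have [m hm] : exists m : nat, 2 / e < m%:R.
    by eexists; apply: archi_boundP; rewrite divr_ge0 // ltW.
  apply: (@le_trans _ _ (Q (~` G m))).
    apply: le_measure; rewrite ?inE.
    + by apply: bigcapT_measurable => k; exact: measurableC.
    + exact: measurableC.
    + by move=> w; apply.
  rewrite probability_setC // leeBlDr ?fin_num_measure //.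
  apply: le_trans (leeD (lexx _) (QG m)); rewrite -EFinD lee_fin.
  have : 2 * (200 + m)%:R^-1 <= e.
    rewrite ler_pdivrMr ?ltr0n // mulrC -ler_pdivrMr // (le_trans (ltW hm)) // ler_nat.
    exact: leq_addl.
  by lra.
- move=> w0 /= bad k _ gk; apply: bad => d Om P omega.
  by apply: surviving_percolates p0 p1 _ => N; exact: gk.
Qed.
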